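(* Let $d\ge5$. (1) Let $\kappa>1/d$. There exists an i.i.d. law $\mathbb P$ on nearest-neighbor conductances $\omega=(\omega_b)_{b\in\mathbb B}\in[0,1]^{\mathbb B}$ with $\mathbb P(\omega_b>0)>p_c(d)$ and an a.s. positive random variable $C=C(\omega)$ such that for $\mathbb P$-almost every $\omega\in\{0\in\mathscr C_\infty\}$, $$\mathsf P_\omega^{2n}(0,0)\ge C(\omega)\,\frac{e^{-(\log n)^\kappa}}{n^2},\qquad n\ge1.$$ (2) For every increasing sequence $\{\lambda_n\}_{n=1}^\infty$ of real numbers with $\lambda_n\to\infty$, there exists an i.i.d. law $\mathbb P$ on nearest-neighbor conductances $\omega=(\omega_b)_{b\in\mathbb B}\in[0,1]^{\mathbb B}$ with $\mathbb P(\omega_b>0)>p_c(d)$, an a.s. positive random variable $C=C(\omega)$, and a strictly increasing sequence of positive integers $(n_k)_{k\ge1}$ not depending on $\omega$, such that for $\mathbb P$-almost every $\omega\in\{0\in\mathscr C_\infty\}$, $$\mathsf P_\omega^{n}(0,0)\ge \frac{C(\omega)}{\lambda_n n^2}\qquad\text{for all } n\in\{n_k:k\ge1\}.$$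
   Context: $\mathbb B$ is the set of unordered pairs of nearest neighbors of $\mathbb Z^d$; for $b=\{x,y\}$ write $\omega_{xy}=\omega_{yx}=\omega_b$, and set $\omega_{xy}=0$ if $x,y$ are not nearest neighbors. Let $\pi_\omega(x)=\sum_y\omega_{xy}$. The discrete-time random walk in environment $\omega$ has transition matrix $\mathsf P_\omega(x,y)=\omega_{xy}/\pi_\omega(x)$ (for $\pi_\omega(x)>0$), and $\mathsf P_\omega^n(x,y)$ denotes its $n$-step transition probability. $\mathscr C_\infty=\mathscr C_\infty(\omega)$ is the set of sites that have a path to infinity along bonds with positive conductances. $p_c(d)$ is the threshold for bond percolation on $\mathbb Z^d$. *)

(* Defs.v *)
From HB Require Import structures.
From mathcomp Require Import all_boot all_order all_algebra finmap.
From mathcomp Require Import all_classical all_reals all_analysis.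

Set Implicit Arguments.
Unset Strict Implicit.
Unset Printing Implicit Defensive.

Import Order.TTheory GRing.Theory Num.Theory.
Import numFieldNormedType.Exports.

Local Open Scope classical_set_scope.
Local Open Scope ring_scope.

Definition vertex (d : nat) := 'rV[int]_d.

Definition origin (d : nat) : vertex d := 0.

Definition nearest_neighbors (d : nat) (x y : vertex d) : bool :=
  \sum_(i < d) `|x ord0 i - y ord0 i| == 1 :> int.

Record bond (d : nat) := Bond {
  bond_ends : {fset vertex d};
  _ : `[< exists x y : vertex d,
            nearest_neighbors x y /\ bond_ends = [fset x; y]%fset >] }.
HB.instance Definition _ (d : nat) := [isSub for @bond_ends d].
HB.instance Definition _ (d : nat) := [Countable of bond d by <:].

Record conductance (R : realType) := Conductance {
  conductance_val :> R;
  _ : (0 <= conductance_val <= 1)%R }.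
HB.instance Definition _ (R : realType) := [isSub for @conductance_val R].
HB.instance Definition _ (R : realType) := [Choice of conductance R by <:].

Lemma conductance0_subproof (R : realType) : (0 <= (0 : R) <= 1)%R.
Proof. by rewrite lexx ler01. Qed.

HB.instance Definition _ (R : realType) :=
  isPointed.Build (conductance R) (Conductance (conductance0_subproof R)).

Definition cylinder_events (d : nat) (R : realType) :
    set (set (bond d -> conductance R)) :=
  [set E | exists b : bond d, exists2 A : set R, measurable A &
     E = [set w : bond d -> conductance R | A (w b)]].

(* [0,1]^B with the product sigma-algebra *)
Definition environment (d : nat) (R : realType) :=
  g_sigma_algebraType (@cylinder_events d R).

Definition iid_law (d : nat) (R : realType)
    (P : probability (environment d R) R) : Prop :=
  (forall (b b' : bond d) (A : set R), measurable A ->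
     P [set w : environment d R | A (w b)] =
     P [set w : environment d R | A (w b')]) /\
  (forall (F : {fset bond d}) (A : bond d -> set R),
     (forall b, measurable (A b)) ->
     P [set w : environment d R | forall b, b \in F -> A b (w b)] =
     (\prod_(b <- F) P [set w : environment d R | A b (w b)])%E).

Section RandomWalk.
Variables (d : nat) (R : realType) (w : environment d R).
Implicit Types (x y : vertex d) (n : nat).

(* insub fails exactly when {x, y} is not a bond, and then the value is 0 *)
Definition cond x y : R :=
  oapp (fun b : bond d => w b : R) 0 (insub [fset x; y]%fset).

(* \sum_(_ \in _) is 0 on infinitely supported families; the sums below have
   at most 2d nonzero terms *)
Definition total_cond x : R := \sum_(y \in [set: vertex d]) cond x y.

(* equal to 0 when total_cond x = 0, where the walk is undefined *)
Definition transition x y : R := cond x y / total_cond x.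

Fixpoint nstep n x y : R :=
  if n is m.+1 then
    \sum_(z \in [set: vertex d]) (transition x z * nstep m z y)
  else (x == y)%:R.

(* The graph being locally finite, an injective path leaves every finite set *)
Definition infinite_cluster : set (vertex d) :=
  [set x | exists f : nat -> vertex d,
     [/\ f 0%N = x, injective f & forall n, 0 < cond (f n) (f n.+1)]].

End RandomWalk.

(* Bernoulli bond percolation: a bond is open when its conductance is 1 and
   closed when it is 0 *)
Definition percolation_law (d : nat) (R : realType) (p : R)
    (Q : probability (environment d R) R) : Prop :=
  iid_law Q /\
  forall b : bond d,
    Q [set w : environment d R | w b = 1 :> R] = p%:E /\
    Q [set w : environment d R | w b = 0 :> R] = (1 - p)%:E.

(* p_c(d) = inf {p | P_p(0 is connected to infinity) > 0}; the law P_p is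
   determined by percolation_law p *)
Definition percolation_threshold (d : nat) (R : realType) : R :=
  inf [set p : R | 0 <= p <= 1 /\
    exists2 Q : probability (environment d R) R, percolation_law p Q &
      (0 < Q [set w | infinite_cluster w (origin d)])%E].

(* Main.v *)
(* A bond of conductance 1 whose other adjacent bonds have conductance at most
   delta, one of them being exactly delta, is a trap: entering it, staying for
   time n of order 1 / delta and leaving costs n^-2 up to a constant. Give each
   bond the conductance v I, where v is decreasing and P(I >= k) = (k+1)^(-1/m).
   A box of side y^e, y about k^(1/m), then contains a trap of scale k when
   d e >= m + 4 d + 2. Moreover bonds of index above y are so rare at that scale
   that every sub-box of a fixed large side has slabs, orthogonal to e_0 and to
   e_1, without such bonds; following these slabs the walk reaches the trap in
   O(y^e) steps of conductance at least v y. By Borel-Cantelli this holds for all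
   large k. For v k = 2^-k the cost of the journey is exp(-O(y^(e+1))), which for
   m close to (e-4) d and e large beats exp(-(log n)^kappa) if kappa > 1/d. For
   v k = 2^-(s k) with s sparse, it involves v y >= v (k-1) only, and is
   negligible compared with lambda at times of order 2^(s k).

   All conductances are positive, so what remains is that p_c < 1. A
   second-moment argument does this for d >= 5: oriented paths using directions
   t mod 4 or t mod 4 + 1 at time t meet as rarely as four independent walks on
   the integers return to 0 simultaneously, which makes the Green function
   finite. *)

Require Import Defs.
From HB Require Import structures.
From mathcomp Require Import all_boot all_order all_algebra finmap.
From mathcomp Require Import all_classical all_reals all_analysis.
From mathcomp Require Import measurable_realfun ring lra zify.

Set Implicit Arguments.
Unset Strict Implicit.
Unset Printing Implicit Defensive.

Import Order.TTheory GRing.Theory Num.Theory.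
Import numFieldNormedType.Exports.

Local Open Scope classical_set_scope.
Local Open Scope ring_scope.

(** * Independent conductances with a prescribed index law *)

(** The exponents balance a count against a price. A block carries a trap of scale k when its gate
    has index exactly k, of probability at least of order y^-(m+1), and at most 4 d touching bonds
    have index at least k, each of probability at least 1/y; the remaining bonds have index 0, at a
    fixed price. So y^(d e) disjoint blocks all fail with probability at most exp(-c y). On the
    other side log n is of order k, hence of order y^m, and the journey asks for e + 1 < kappa m.
    With m = (e-4) d - 2 the ratio (e+1)/m tends to 1/d, which is where the bound on kappa comes
    from.

    The obstacle is the journey: a bond has index above y with probability of order y^(-1/m) only,
    far too much for a union bound over the box. Hence a sub-box offers K parallel slabs, which are
    spoiled by distinct bonds; K = m (d e + 2 m) makes the probability y^-(d e + 2 m), and the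
    surplus y^(-2 m), at most k^-2, is summable. The sub-box at the origin is fixed, so it is only
    clean beyond a random scale; such finitely many exceptional times are absorbed by C. *)

Lemma lebesgue_measure_affine (R : realType) (c p : R) (A : set R) :
  0 < p -> measurable A ->
  lebesgue_measure ((fun u => (u - c) / p) @^-1` A) = (p%:E * lebesgue_measure A)%E.
Proof.
move=> p0 mA.
have maff : measurable_fun [set: measurableTypeR R]
    ((fun u => (u - c) / p) : measurableTypeR R -> measurableTypeR R).
  apply: measurable_funM => //; apply: measurable_funD => //.
pose aff : measurableTypeR R -> measurableTypeR R := fun u => (u - c) / p.
have pV0 : 0 <= p^-1 by rewrite invr_ge0 ltW.
pose m := mscale (NngNum pV0) (pushforward lebesgue_measure aff).
have mE B : m maff B = (p^-1%:E * lebesgue_measure (aff @^-1` B))%E by [].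
(* The rescaled pushforward gives half-open intervals their length, which characterizes Lebesgue
   measure. *)
have : lebesgue_measure A = m maff A.
  apply: lebesgue_measure_unique => // _ [[a b]] _ <-.
  rewrite -[RHS]/(p^-1%:E * lebesgue_measure (aff @^-1` [set` `]a, b]]))%E.
  rewrite [X in (_ * lebesgue_measure X)%E](_ : _ =
      `](p * a + c), (p * b + c)]%classic); last first.
    apply/seteqP; split => x /=; rewrite /aff !in_itv/=.
      by rewrite ltr_pdivlMr// ler_pdivrMr// ltrBrDr lerBlDr ![_ * p]mulrC.
    by rewrite ltr_pdivlMr// ler_pdivrMr// ltrBrDr lerBlDr ![_ * p]mulrC.
  rewrite !lebesgue_measure_itv/= !lte_fin ltrD2r ltr_pM2l//.
  case: ifPn => [ab|]; last by rewrite mule0.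
  rewrite -!EFinD -EFinM; congr (_%:E).
  by rewrite opprD addrACA subrr addr0 -mulrBr mulrA mulVf ?mul1r ?gt_eqF.
rewrite mE => ->.
by rewrite muleA -EFinM divff ?mul1e ?gt_eqF.
Qed.

Section iid_sequence.
Variables (R : realType) (T : nat -> R).
Hypotheses (T0 : T 0%N = 1) (Tni : forall k, T k.+1 <= T k)
  (Tcv : T @ \oo --> (0 : R)).

Local Notation mu := (@lebesgue_measure R).
Local Notation unit_itv := (`[0, 1[%classic : set R).
Local Notation cell k := (`[1 - T k, 1 - T k.+1[%classic : set R).
Local Notation aff k := (fun u : R => (u - (1 - T k)) / (T k - T k.+1)).

(** First digit of [u]: the cells partition the unit interval, and the default 0 is taken only
    outside it. *)
Definition cell_index (u : R) : nat := xget 0%N [set k | cell k u].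

Definition cell_rescale (u : R) : R := aff (cell_index u) u.

Let Tmono m n : (m <= n)%N -> T n <= T m.
Proof. by move: m n; apply: (@nonincreasing_seqP _ R T).1. Qed.

Let T_ge0 k : 0 <= T k.
Proof.
rewrite leNgt; apply/negP => Tk.
have /cvgr_gt/(_ (T k) Tk)[N _ HN] := Tcv.
have := HN (maxn N k) (leq_maxl _ _).
by rewrite ltNge Tmono// leq_maxr.
Qed.

Lemma cell_inj u k l : cell k u -> cell l u -> k = l.
Proof.
wlog kl : k l / (k <= l)%N.
  by move=> h ku lu; case/orP: (leq_total k l) => /h; [exact|move/(_ lu ku)].
rewrite /= !in_itv/= => /andP[_ uk] /andP[lu _].
apply/eqP; rewrite eqn_leq kl /= leqNgt; apply/negP => kl'.
have := lt_le_trans (le_lt_trans lu uk) (lerB (lexx 1) (Tmono kl')).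
by rewrite ltxx.
Qed.

Lemma cell_indexP u : unit_itv u -> cell (cell_index u) u.
Proof.
rewrite /= in_itv/= => /andP[u0 u1].
rewrite /cell_index; case: xgetP => [k _ //|H].
have exk : exists k, u < 1 - T k.
  have : 0 < 1 - u by rewrite subr_gt0.
  move/(cvgr_lt _ Tcv) => [N _ HN]; exists N.
  by have := HN N (leqnn _) => /=; rewrite ltrBrDl addrC -ltrBrDl.
case: (ex_minnP exk) => -[|k] uk kmin.
  by move: uk; rewrite T0 subrr ltNge u0.
case: (H k) => /=; rewrite in_itv/= uk andbT leNgt; apply/negP => /kmin.
by rewrite ltnn.
Qed.

Lemma cell_sub k : cell k `<=` unit_itv.
Proof.
move=> u; rewrite /= !in_itv/= => /andP[a b]; apply/andP; split.
  by rewrite (le_trans _ a)// subr_ge0 -T0 Tmono.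
by rewrite (lt_le_trans b)// gerBl.
Qed.

Lemma cell_index_cell u k : cell k u -> cell_index u = k.
Proof.
by move=> ku; apply: cell_inj (ku); apply/cell_indexP/cell_sub; exact: ku.
Qed.

Lemma cell_aff k u : T k.+1 < T k -> cell k u = unit_itv (aff k u).
Proof.
move=> tk; have tk0 : 0 < T k - T k.+1 by rewrite subr_gt0.
rewrite /= !in_itv/= ler_pdivlMr// mul0r subr_ge0 ltr_pdivrMr// mul1r.
by rewrite ltrBlDr (_ : T k - T k.+1 + (1 - T k) = 1 - T k.+1); last by ring.
Qed.

Lemma cell_rescale_unit u : unit_itv u -> unit_itv (cell_rescale u).
Proof.
move=> /cell_indexP; rewrite /cell_rescale; move: (cell_index u) => k ku.
rewrite -cell_aff//; move: ku; rewrite /= in_itv/= => /andP[a b].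
by have := le_lt_trans a b; rewrite ltrD2l ltrN2.
Qed.

Definition digits_in (n : nat) (X : nat -> set nat) : set R :=
  [set u | unit_itv u /\
     forall i, (i < n)%N -> X i (cell_index (iter i cell_rescale u))].

(** Split along the first digit: on the k-th cell the rescaling is the affine map [aff k], and the
    later digits of [u] are the digits of its image. *)
Lemma digits_inS n X : digits_in n.+1 X =
  \bigcup_(k in X 0%N) (cell k `&` aff k @^-1` digits_in n (X \o succn)).
Proof.
apply/seteqP; split => u.
  move=> [u01 Xu]; exists (cell_index u); first exact: (Xu 0%N).
  split; first exact: cell_indexP.
  split; first exact: cell_rescale_unit.
  by move=> i /= ni; have := Xu i.+1 ni; rewrite iterSr.
move=> [k Xk [ku [uk Xu]]]; have iu := cell_index_cell ku.
split; first exact: cell_sub ku.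
move=> [|i] ni; first by rewrite /= iu.
have ru : cell_rescale u = aff k u by rewrite /cell_rescale iu.
by rewrite iterSr ru; exact: Xu.
Qed.

Lemma digits_in_measurable_cell n X k : measurable (digits_in n X) ->
  measurable (cell k `&` aff k @^-1` digits_in n X) /\
  mu (cell k `&` aff k @^-1` digits_in n X) =
    ((T k - T k.+1)%:E * mu (digits_in n X))%E.
Proof.
move=> mD; have maff : measurable_fun [set: measurableTypeR R] (aff k).
  by apply: measurable_funM => //; apply: measurable_funD.
have mpre : measurable (aff k @^-1` digits_in n X).
  by rewrite -[X in measurable X]setTI; exact: maff.
split; first exact: measurableI.
(* When [T k.+1 = T k] the cell is empty and [aff k] divides by zero, so this case is separate. *)
have := Tni k; rewrite le_eqVlt => /predU1P[<-|tk].
  by rewrite subrr mul0e set_itv_ge ?set0I ?measure0// bnd_simp ltxx.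
rewrite -(lebesgue_measure_affine (1 - T k)) ?subr_gt0//; congr (mu _).
apply/seteqP; split => [u []//|u Du]; split => //.
by rewrite (cell_aff _ tk); exact: Du.1.
Qed.

Lemma digits_in_prod n X : measurable (digits_in n X) /\
  mu (digits_in n X) = (\prod_(i < n) mu (digits_in 1 (fun=> X i)))%E.
Proof.
have disj (D : set nat) (F : nat -> set R) :
    trivIset D (fun k => cell k `&` F k).
  by move=> k l _ _ [u [[+ _] [+ _]]]; exact: cell_inj.
have D0 Y : digits_in 0 Y = unit_itv.
  by apply/seteqP; split => [u []|u u01].
have mu01 : mu unit_itv = 1%E.
  by rewrite lebesgue_measure_itv/= lte_fin ltr01 oppr0 adde0.
(* Every cell contributes its length times the same measure of the later digits, so the sum over the
   first digit factors out. *)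
have step m Y : measurable (digits_in m (Y \o succn)) ->
    measurable (digits_in m.+1 Y) /\ mu (digits_in m.+1 Y) =
     (mu (digits_in m (Y \o succn)) * \sum_(k <oo | k \in Y 0%N) (T k - T k.+1)%:E)%E.
  move=> mY; rewrite digits_inS; split.
    by apply: bigcup_measurable => k _; exact: (digits_in_measurable_cell k mY).1.
  rewrite measure_bigcup//=; last first.
    by move=> k _; exact: (digits_in_measurable_cell k mY).1.
  have fY : mu (digits_in m (Y \o succn)) \is a fin_num.
    rewrite ge0_fin_numE// (@le_lt_trans _ _ 1%E) ?ltry// -mu01.
    by rewrite le_measure ?inE// => u [].
  rewrite -(fineK fY) -nneseriesZl; last first.
    by move=> k _; rewrite lee_fin subr_ge0.
  apply: eq_eseriesr => k _.
  by rewrite (digits_in_measurable_cell k mY).2 fineK// muleC.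
have one Y : measurable (digits_in 1 Y) /\
    mu (digits_in 1 Y) = (\sum_(k <oo | k \in Y 0%N) (T k - T k.+1)%:E)%E.
  have [] := @step 0%N Y; first by rewrite D0.
  by move=> m1 m2; split => //; rewrite m2 D0 mu01 mul1e.
elim: n X => [|n IH] X; first by rewrite D0 big_ord0.
have [mX muX] := IH (X \o succn).
have [mS muS] := step _ _ mX.
split => //; rewrite muS big_ord_recl muX muleC; congr (_ * _)%E.
by rewrite (one (fun=> X 0%N)).2.
Qed.

Lemma digits_in_tail i : mu (digits_in 1 (fun=> [set k | (i <= k)%N])) = (T i)%:E.
Proof.
have -> : digits_in 1 (fun=> [set k | (i <= k)%N]) = `[1 - T i, 1[%classic.
  apply/seteqP; split => u.
    move=> [u01 /(_ 0%N isT)/= ik].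
    have := cell_indexP u01; rewrite /= !in_itv/= => /andP[a b].
    rewrite (lt_le_trans b) ?gerBl// andbT (le_trans _ a)// lerB//.
    exact: Tmono.
  rewrite /= !in_itv/= => /andP[iu u1].
  have u01 : unit_itv u.
    by rewrite /= in_itv/= u1 (le_trans _ iu)// subr_ge0 -T0 Tmono.
  split => // -[|//] _ /=.
  have := cell_indexP u01; rewrite /= in_itv/= => /andP[a b].
  rewrite leqNgt; apply/negP => ki.
  have := lt_le_trans (le_lt_trans iu b) (lerB (lexx 1) (Tmono ki)).
  by rewrite ltxx.
rewrite lebesgue_measure_itv/= lte_fin gtrBl.
have := T_ge0 i; rewrite le_eqVlt => /predU1P[<-|->]; first by rewrite ltxx.
by rewrite -EFinD opprB addrC subrK.
Qed.

End iid_sequence.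

(* The i-th bond of an enumeration gets the i-th digit of a uniform variable in
   the expansion whose k-th cell has length T k - T k.+1; the digits are
   independent because rescaling a cell to [0, 1[ preserves the uniform law. *)
Lemma iid_law_exists (R : realType) (d : nat) (T : nat -> R)
    (v : nat -> conductance R) :
  T 0%N = 1 -> (forall k, T k.+1 <= T k) -> T @ \oo --> (0 : R) ->
  exists P : probability (environment d R) R, iid_law P /\
    forall (b : bond d) (A : set R) i, measurable A ->
      (forall k, A (v k) <-> (i <= k)%N) ->
      P [set w : environment d R | A (w b)] = (T i)%:E.
Proof.
move=> T0 Tni Tcv.
pose I : set (measurableTypeR R) := `[0, 1[%classic.
have mI : measurable I by exact: measurable_itv.
pose dig i u := cell_index T (iter i (cell_rescale T) u).
pose phi (u : measurableTypeR R) : environment d R :=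
  fun b : bond d => if u \in I then v (dig (choice.pickle b) u) else v 0%N.
have Dprod := digits_in_prod T0 Tni Tcv.
have phiI u b : I u -> phi u b = v (dig (choice.pickle b) u).
  by move=> Iu; rewrite /phi mem_set.
have D1 A i : measurable (I `&` [set u | A (v (dig i u))] : set R) /\
    lebesgue_measure (I `&` [set u | A (v (dig i u))]) =
    lebesgue_measure (digits_in T 1 (fun=> [set k | A (v k)])).
  have -> : I `&` [set u | A (v (dig i u))] =
      digits_in T i.+1 (fun j => if j == i then [set k | A (v k)] else setT).
    apply/seteqP; split => u [Iu Au]; split => //.
      by move=> j _; case: eqP => [->|].
    by have := Au i (ltnSn i); rewrite eqxx.
  have [mD ->] := Dprod i.+1 (fun j => if j == i then [set k | A (v k)] else setT).
  split => //; rewrite big_ord_recr/= eqxx big1 ?mul1e// => j _.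
  rewrite (ltn_eqF (ltn_ord j)).
  have -> : digits_in T 1 (fun=> setT) = I by apply/seteqP; split => u // [].
  by rewrite lebesgue_measure_itv/= lte_fin ltr01 oppr0 adde0.
have mphi : measurable_fun setT phi.
  apply: (@measurability _ _ _ (environment d R) setT phi (@cylinder_events d R)) => //.
  move=> _ [_ [b [A mA ->]] <-]; rewrite setTI.
  have -> : phi @^-1` [set w | A (w b)] =
      (I `&` [set u | A (v (dig (choice.pickle b) u))]) `|`
      (~` I `&` [set _ | A (v 0%N)]).
    apply/seteqP; split => u /=.
      have [/set_mem Iu|/negP nIu] := boolP (u \in I); first by left; rewrite -phiI.
      right; split; first by move=> Iu; apply: nIu; exact/mem_set.
      by move: H; rewrite /phi (negbTE (introN idP nIu)).
    move=> [[Iu Au]|[nIu Av]]; first by rewrite phiI.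
    by rewrite /phi memNset.
  apply: measurableU; first exact: (D1 A _).1.
  apply: measurableI; first exact: measurableC.
  by have [Av|nAv] := pselect (A (v 0%N)); [rewrite (_ : [set _ | _] = setT)
    |rewrite (_ : [set _ | _] = set0)] => //; apply/seteqP; split.
pose m := mrestr (@lebesgue_measure R) mI.
have m1 : m setT = 1%E.
  by rewrite /m /mrestr setTI lebesgue_measure_itv/= lte_fin ltr01 oppr0 adde0.
pose P0 : probability (measurableTypeR R) R :=
  HB.pack m (Measure_isProbability.Build _ _ _ m m1).
pose X : {mfun measurableTypeR R >-> environment d R} :=
  HB.pack phi (isMeasurableFun.Build _ _ _ _ _ mphi).
pose P : probability (environment d R) R := distribution P0 X.
exists P.
have PE (E : set (environment d R)) :
  P E = lebesgue_measure (I `&` phi @^-1` E).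
  by rewrite setIC.
have PA b (A : set R) : P [set w : environment d R | A (w b)] =
    lebesgue_measure (digits_in T 1 (fun=> [set k | A (v k)])).
  rewrite PE -(D1 A (choice.pickle b)).2; congr (lebesgue_measure _).
  by apply/seteqP; split => u [Iu]; rewrite /= phiI.
split; last first.
  move=> b A i mA Ai; rewrite PA -(digits_in_tail T0 Tni Tcv); congr (lebesgue_measure _).
  by congr (digits_in _ _ _); apply/funext => _; apply/seteqP; split => k /= /Ai.
split; first by move=> b b' A mA; rewrite !PA.
move=> F A mA.
pose n := (\max_(b <- F) (choice.pickle b).+1)%N.
have bn b : b \in F -> (choice.pickle b < n)%N.
  by move=> bF; rewrite /n (big_rem b bF)/= leq_max ltnSn.
(* [choice.pickle] is injective, so digit [i] is constrained by at most one bond of [F], and not at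
   all when no bond of [F] has number [i]. *)
pose Y i : set nat := [set k | forall b, b \in F -> choice.pickle b = i -> A b (v k)].
have -> : P [set w : environment d R | forall b, b \in F -> A b (w b)] =
    lebesgue_measure (digits_in T n Y).
  rewrite PE; congr (lebesgue_measure _); apply/seteqP; split => u [Iu Au]; split=> //.
    by move=> i ni b bF <-; have := Au b bF; rewrite phiI.
  by move=> b bF; rewrite phiI//; exact: (Au _ (bn b bF) b bF erefl).
rewrite (Dprod n Y).2.
have Y1 i : lebesgue_measure (digits_in T 1 (fun=> Y i)) =
    (\prod_(b <- F | choice.pickle b == i) P [set w : environment d R | A b (w b)])%E.
  have [[b bF bi]|nb] := pselect (exists2 b, b \in F & choice.pickle b = i).
    rewrite (big_rem b bF)/= bi eqxx big1_seq ?mule1.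
      transitivity (P [set w : environment d R | A b (w b)]); last by [].
      rewrite PA; congr (lebesgue_measure _); congr (digits_in _ _ _).
      apply/funext => _; apply/seteqP; split => k /=; first exact.
      move=> Ak b' b'F; rewrite -bi => /(pcan_inj choice.pickleK) ->; exact: Ak.
    move=> b' /andP[/eqP b'i]; rewrite mem_rem_uniq ?fset_uniq// inE => /andP[/eqP nbb _].
    by case: nbb; apply: (pcan_inj choice.pickleK); rewrite b'i bi.
  rewrite big1_seq.
    have -> : digits_in T 1 (fun=> Y i) = I.
      apply/seteqP; split => u => [[]//|Iu]; split => // -[|//] _ b bF bi.
      by case: nb; exists b.
    by rewrite lebesgue_measure_itv/= lte_fin ltr01 oppr0 adde0.
  by move=> b /andP[/eqP bi bF]; case: nb; exists b.
under eq_bigr do rewrite Y1.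
rewrite (exchange_big_dep xpredT)//=.
rewrite big_seq [RHS]big_seq; apply: eq_bigr => b bF.
by rewrite (big_pred1 (Ordinal (bn b bF)))// => j; rewrite -val_eqE/= eq_sym.
Qed.

(** * The walk on the lattice *)

Section lattice.
Variable d : nat.
Implicit Types (x y : vertex d) (i j : 'I_d).

Definition dirv i : vertex d := delta_mx ord0 i.

Lemma dirvE i j : dirv i ord0 j = (j == i)%:R.
Proof. by rewrite mxE eqxx. Qed.

Lemma nearest_neighborsC x y : nearest_neighbors x y = nearest_neighbors y x.
Proof. by rewrite /nearest_neighbors; under eq_bigr do rewrite distrC. Qed.

Lemma nearest_neighbors_dirv x i : nearest_neighbors x (x + dirv i).
Proof.
rewrite /nearest_neighbors (bigD1 i)//= big1 => [|j ji].
  by rewrite addr0 mxE dirvE eqxx opprD addNKr normrN normr1.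
by rewrite mxE dirvE (negbTE ji) addr0 subrr normr0.
Qed.

Lemma nearest_neighborsP x y :
  nearest_neighbors x y -> exists i, y = x + dirv i \/ x = y + dirv i.
Proof.
move=> xy; have [i xyi] : exists i, x ord0 i - y ord0 i != 0.
  apply: contrapT => /forallNP h; move: xy; rewrite /nearest_neighbors big1//.
  by move=> i _; apply/eqP; rewrite normr_eq0; apply: contraT => /(h i).
exists i; move: xy; rewrite /nearest_neighbors (bigD1 i)//=.
set s := \sum_(j < d | _) _ => /eqP xys.
have s0 : 0 <= s by apply: sumr_ge0.
have xi1 : 1 <= `|x ord0 i - y ord0 i| by rewrite -gtz0_ge1 normr_gt0.
have /eqP : s = 0 by lia.
rewrite psumr_eq0// => /allP sz.
have xyj j : j != i -> x ord0 j = y ord0 j.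
  move=> ji; have := sz j (mem_index_enum _); rewrite ji/= normr_eq0.
  by rewrite subr_eq0 => /eqP.
have : y ord0 i = x ord0 i + 1 \/ x ord0 i = y ord0 i + 1 by lia.
by case=> h; [left|right]; apply/rowP => j; rewrite mxE dirvE;
  case: eqVneq => [->|/xyj ->]; rewrite ?addr0.
Qed.

Definition height x : int := \sum_i x ord0 i.

Lemma heightD x y : height (x + y) = height x + height y.
Proof. by rewrite /height -big_split; apply: eq_bigr => i _; rewrite mxE. Qed.

Lemma height_dirv i : height (dirv i) = 1.
Proof.
rewrite /height (bigD1 i)//= big1 => [|j ji]; first by rewrite dirvE eqxx addr0.
by rewrite dirvE (negbTE ji).
Qed.

Lemma dirv_inj : injective dirv.
Proof.
by move=> i j /rowP/(_ i); rewrite !dirvE eqxx; case: eqVneq.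
Qed.

Lemma dirv_neq0 i : dirv i != 0.
Proof. by apply/eqP => /rowP/(_ i); rewrite dirvE eqxx mxE. Qed.

Fact ubond_subproof x i : `[< exists y z : vertex d,
  nearest_neighbors y z /\ [fset x; (x + dirv i)%R]%fset = [fset y; z]%fset >].
Proof. by apply/asboolP; exists x, (x + dirv i); rewrite nearest_neighbors_dirv. Qed.

Definition ubond x i : bond d := Bond (ubond_subproof x i).

(** The lower end in [height] is intrinsic to the unordered pair: exchanging the ends would raise
    the height twice around a loop. *)
Lemma ubond_inj x y i j : ubond x i = ubond y j -> x = y /\ i = j.
Proof.
move=> /(congr1 (@bond_ends d))/= /fsetP E.
have := E x; rewrite !inE eqxx/= => /esym/orP[/eqP xy|/eqP xy].
  split=> //; have := E (x + dirv i); rewrite !inE eqxx orbT xy => /esym/orP[|].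
    by rewrite addrC -subr_eq0 addrK (negbTE (dirv_neq0 i)).
  by move=> /eqP/addrI/dirv_inj.
have := E y; rewrite !inE eqxx/= xy => /orP[|].
  by rewrite addrC -subr_eq0 -opprB addrK oppr_eq0 (negbTE (dirv_neq0 j)).
by move=> /eqP/(congr1 height); rewrite !heightD !height_dirv; lia.
Qed.

Definition nbrs x : seq (vertex d) :=
  undup ([seq x + dirv i | i : 'I_d] ++ [seq x - dirv i | i : 'I_d]).

Lemma mem_nbrs x y : (y \in nbrs x) = nearest_neighbors x y.
Proof.
rewrite mem_undup mem_cat; apply/orP/idP.
  case=> /mapP[i _ ->]; first exact: nearest_neighbors_dirv.
  by rewrite nearest_neighborsC -{2}(subrK (dirv i) x) nearest_neighbors_dirv.
move=> /nearest_neighborsP[i [->|->]]; [left|right].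
  by apply/mapP; exists i; rewrite ?mem_enum.
by apply/mapP; exists i; rewrite ?mem_enum// addrK.
Qed.

Lemma size_nbrs x : (size (nbrs x) <= 2 * d)%N.
Proof.
by rewrite (leq_trans (size_undup _))// size_cat !size_image card_ord mul2n addnn.
Qed.

End lattice.

Section walk.
Variables (d : nat) (R : realType).
Implicit Types (x y z : vertex d) (w : environment d R).

Lemma cond_ubond w x i : cond w x (x + dirv i) = w (ubond x i).
Proof.
rewrite /cond (_ : [fset x; (x + dirv i)%R]%fset = val (ubond x i))// valK //.
Qed.

Lemma condC w x y : cond w x y = cond w y x.
Proof. by rewrite /cond fsetUC. Qed.

Lemma cond_ubondN w x i : cond w (x + dirv i) x = w (ubond x i).
Proof. by rewrite condC cond_ubond. Qed.

Lemma cond_eq0 w x y : ~~ nearest_neighbors x y -> cond w x y = 0.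
Proof.
move=> xy; rewrite /cond; case: insubP => [b /asboolP[x' [y' [xy' E]]] _|//].
exfalso; move/negP: xy; apply; have /fsetP F := E.
have := F x; rewrite !inE eqxx/= => /esym/orP[/eqP xx|/eqP xx];
  have := F y; rewrite !inE eqxx orbT => /esym/orP[/eqP yy|/eqP yy].
- have := F y'; rewrite !inE eqxx orbT yy -xx orbb => /eqP yx.
  by move: xy'; rewrite -xx yx.
- by rewrite xx yy.
- by rewrite xx yy nearest_neighborsC.
have := F x'; rewrite !inE eqxx yy -xx orbb => /eqP yx.
by move: xy'; rewrite -xx yx.
Qed.

Lemma cond_ge0_le1 w x y : 0 <= cond w x y <= 1.
Proof.
rewrite /cond; case: insub => [b|] /=; last by rewrite lexx ler01.
by case: (w b).
Qed.

Lemma cond_ge0 w x y : 0 <= cond w x y.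
Proof. by case/andP: (cond_ge0_le1 w x y). Qed.

Lemma cond_le1 w x y : cond w x y <= 1.
Proof. by case/andP: (cond_ge0_le1 w x y). Qed.

Lemma nbrs_sum (F : vertex d -> R) x :
  (forall y, ~~ nearest_neighbors x y -> F y = 0) ->
  \sum_(y \in [set: vertex d]) F y = \sum_(y <- nbrs x) F y.
Proof.
move=> F0; rewrite (fsbigE (nbrs x)) ?undup_uniq//.
  by apply: eq_bigl => y; rewrite in_setT.
by move=> y _; rewrite mem_nbrs => /F0.
Qed.

Lemma total_condE w x : total_cond w x = \sum_(y <- nbrs x) cond w x y.
Proof. by apply: nbrs_sum => y; exact: cond_eq0. Qed.

Lemma transition_eq0 w x y : ~~ nearest_neighbors x y -> transition w x y = 0.
Proof. by move=> xy; rewrite /transition cond_eq0// mul0r. Qed.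

Lemma nstepS w n x y :
  nstep w n.+1 x y = \sum_(z <- nbrs x) transition w x z * nstep w n z y.
Proof. by apply: nbrs_sum => z /transition_eq0 ->; rewrite mul0r. Qed.

Lemma total_cond_ge0 w x : 0 <= total_cond w x.
Proof. by rewrite total_condE sumr_ge0// => y _; exact: cond_ge0. Qed.

Lemma total_cond_le w x : total_cond w x <= (2 * d)%:R.
Proof.
rewrite total_condE (@le_trans _ _ (\sum_(y <- nbrs x) 1))//.
  by apply: ler_sum => y _; exact: cond_le1.
by rewrite big_const_seq iter_addr_0 count_predT ler_nat size_nbrs.
Qed.

Lemma transition_ge0 w x y : 0 <= transition w x y.
Proof. by rewrite divr_ge0 ?cond_ge0 ?total_cond_ge0. Qed.

(** Conductances are at most 1, so the total conductance at a site is at most 2 d. *)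
Lemma transition_ge w x y : cond w x y / (2 * d)%:R <= transition w x y.
Proof.
have := cond_ge0 w x y; rewrite le_eqVlt => /predU1P[c0|c0].
  by rewrite -c0 mul0r transition_ge0.
apply: ler_pM => //; rewrite ?cond_ge0 ?invr_ge0 //.
have T0 : 0 < total_cond w x.
  have [xy|xy] := boolP (nearest_neighbors x y); last by move: c0; rewrite cond_eq0 ?ltxx.
  rewrite total_condE (big_rem y) ?mem_nbrs//= ltr_pwDl// sumr_ge0// => z _.
  exact: cond_ge0.
by rewrite lef_pV2 ?posrE ?total_cond_le// (lt_le_trans T0)// total_cond_le.
Qed.

Lemma nstep_ge0 w n x y : 0 <= nstep w n x y.
Proof.
elim: n x => [|n IH] x; first by rewrite /= ler0n.
by rewrite nstepS sumr_ge0// => z _; rewrite mulr_ge0 ?transition_ge0.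
Qed.

Lemma nstep1 w x y : nstep w 1 x y = transition w x y.
Proof.
rewrite nstepS; have [xy|xy] := boolP (nearest_neighbors x y); last first.
  rewrite transition_eq0// big1_seq// => z /andP[_]; rewrite mem_nbrs => xz /=.
  by case: eqVneq => [zy|]; rewrite ?mulr0//; move: xz xy; rewrite zy => ->.
rewrite (bigD1_seq y) ?mem_nbrs ?undup_uniq//= eqxx mulr1 big1 ?addr0// => z.
by move=> /negbTE ->; rewrite mulr0.
Qed.

Lemma nstepM w m n x y z : nstep w m x y * nstep w n y z <= nstep w (m + n) x z.
Proof.
elim: m x => [|m IH] x.
  by rewrite /=; case: eqVneq => [->|]; rewrite ?mul1r ?mul0r ?nstep_ge0.
rewrite addSn !nstepS mulr_suml; apply: ler_sum => u _.
by rewrite -mulrA ler_wpM2l ?transition_ge0.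
Qed.

End walk.

(** * Percolation threshold *)

(* Integrate 2 c N <= 1_{N > 0} + (c N)^2, where N counts the events that occur. *)
Lemma second_moment_bound (dT : measure_display) (T : measurableType dT)
    (R : realType) (P : probability T R) (I : choiceType) (s : seq I)
    (A : I -> set T) (c : R) :
  0 <= c -> (forall i, measurable (A i)) ->
  ((2 * c)%:E * \sum_(i <- s) P (A i) <=
   P [set w | exists2 i, i \in s & A i w] +
   (c ^+ 2)%:E * \sum_(i <- s) \sum_(j <- s) P (A i `&` A j))%E.
Proof.
move=> c0 mA; pose U := [set w | exists2 i, i \in s & A i w].
have mU : measurable U.
  rewrite (_ : U = \bigcup_(i in [set` s]) A i).
    by apply: fin_bigcup_measurable => // i _; exact: mA.
  by apply/seteqP; split => w [i si Aw]; exists i.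
have ind B : measurable B -> P B = (\int[P]_w (\1_B w)%:E)%E.
  by move=> mB; rewrite integral_indic// setIT.
have mind B : measurable B -> measurable_fun [set: T] (fun w => (\1_B w : R)%:E).
  by move=> mB; apply/measurable_EFinP; exact: measurable_indic.
have sum1 : (\sum_(i <- s) P (A i) = \int[P]_w \sum_(i <- s) (\1_(A i) w)%:E)%E.
  rewrite ge0_integral_sum//; last by move=> i; exact: mind.
  by apply: eq_bigr => i _; exact: ind.
have sum2 i : (\sum_(j <- s) P (A i `&` A j) =
    \int[P]_w \sum_(j <- s) (\1_(A i `&` A j) w)%:E)%E.
  rewrite ge0_integral_sum//; last by move=> j; apply: mind; exact: measurableI.
  by apply: eq_bigr => j _; apply: ind; exact: measurableI.
have m2 i : measurable_fun [set: T] (fun w => \sum_(j <- s) (\1_(A i `&` A j) w : R)%:E)%E.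
  by apply: emeasurable_sum => j; apply: mind; exact: measurableI.
have sum3 : (\sum_(i <- s) \sum_(j <- s) P (A i `&` A j) =
    \int[P]_w \sum_(i <- s) \sum_(j <- s) (\1_(A i `&` A j) w)%:E)%E.
  rewrite ge0_integral_sum//; last by move=> i w _; rewrite sume_ge0// => *; rewrite lee_fin.
  by apply: eq_bigr => i _; exact: sum2.
have m1 : measurable_fun [set: T] (fun w => \sum_(j <- s) (\1_(A j) w : R)%:E)%E.
  by apply: emeasurable_sum => j; exact: mind.
have m3 : measurable_fun [set: T]
    (fun w => \sum_(i <- s) \sum_(j <- s) (\1_(A i `&` A j) w : R)%:E)%E.
  by apply: emeasurable_sum.
have S1 w : (0 <= \sum_(i <- s) (\1_(A i) w : R)%:E)%E.
  by apply: sume_ge0 => i _; rewrite lee_fin.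
have S2 w : (0 <= \sum_(i <- s) \sum_(j <- s) (\1_(A i `&` A j) w : R)%:E)%E.
  by apply: sume_ge0 => i _; apply: sume_ge0 => j _; rewrite lee_fin.
have c2 : (0 <= (2 * c)%:E)%E by rewrite lee_fin mulr_ge0.
have cc : (0 <= (c ^+ 2)%:E)%E by rewrite lee_fin sqr_ge0.
rewrite sum1 sum3 ind// -!ge0_integralZl//.
rewrite -ge0_integralD//; first last.
- by apply: measurable_funeM.
- by move=> w _; exact: mule_ge0.
- exact: mind.
apply: ge0_le_integral => //.
- by move=> w _; exact: mule_ge0.
- by apply: measurable_funeM.
- by apply: emeasurable_funD; [exact: mind|exact: measurable_funeM].
move=> w _; rewrite sumEFin; under [X in (_ <= _ + _ * X)%E]eq_bigr do rewrite sumEFin.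
rewrite sumEFin -!EFinM -EFinD lee_fin.
have -> : \sum_(i <- s) \sum_(j <- s) \1_(A i `&` A j) w = (\sum_(i <- s) \1_(A i) w) ^+ 2 :> R.
  rewrite expr2 mulr_suml; apply: eq_bigr => i _; rewrite mulr_sumr.
  by apply: eq_bigr => j _; rewrite indicI.
have [Uw|nUw] := pselect (U w).
  rewrite indicE mem_set//= -exprMn; set N := \sum_(_ <- _) _.
  by rewrite -subr_ge0 (_ : _ - _ = (1 - c * N) ^+ 2) ?sqr_ge0//; ring.
rewrite big1_seq ?mulr0 ?expr0n ?mulr0 ?addr0// => i /andP[_ si].
by rewrite indicE memNset// => Aw; apply: nUw; exists i.
Qed.

(** * Measurability of the walk and of the infinite cluster *)

Section measurability.
Variables (d : nat) (R : realType).
Implicit Types (x y : vertex d) (w : environment d R).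

Lemma measurable_bond (b : bond d) (A : set R) : measurable A ->
  measurable [set w : environment d R | A (w b)].
Proof. by move=> mA; apply: sub_sigma_algebra; exists b; exists A. Qed.

Lemma measurable_conductance (b : bond d) :
  measurable_fun [set: environment d R] (fun w => w b : R).
Proof. by move=> _ A mA; rewrite setTI; exact: measurable_bond. Qed.

Lemma measurable_cond x y :
  measurable_fun [set: environment d R] (fun w => cond w x y).
Proof.
rewrite /cond; case: insub => [b|] /=; last exact: measurable_cst.
exact: measurable_conductance.
Qed.

Lemma measurable_transition x y :
  measurable_fun [set: environment d R] (fun w => transition w x y).
Proof.
(* On nonnegative reals, 0 included, inversion is the power -1, whose measurability is available. *)
rewrite (_ : (fun w => _) = (fun w => cond w x y * (total_cond w x `^ (-1)))).
  apply: measurable_funM; first exact: measurable_cond.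
  apply: (measurableT_comp (measurable_powR (-1))).
  rewrite [X in measurable_fun _ X](_ : _ = (fun w : environment d R =>
    \sum_(y <- nbrs x) cond w x y)); last by apply/funext => w; exact: total_condE.
  by apply: measurable_sum => z; exact: measurable_cond.
by apply/funext => w; rewrite powR_inv1 ?total_cond_ge0.
Qed.

Lemma measurable_nstep n x y :
  measurable_fun [set: environment d R] (fun w => nstep w n x y).
Proof.
elim: n x => [|n IH] x; first exact: measurable_cst.
rewrite [X in measurable_fun _ X](_ : _ = (fun w : environment d R =>
  \sum_(z <- nbrs x) transition w x z * nstep w n z y)); last first.
  by apply/funext => w; exact: nstepS.
apply: measurable_sum => z; apply: measurable_funM => //.
exact: measurable_transition.
Qed.

(** Finite-depth version of [infinite_cluster], which depends on finitely many bonds; [past] lists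
    the vertices already visited. *)
Fixpoint self_avoiding w n x (past : seq (vertex d)) : Prop :=
  if n is m.+1 then
    exists y, [/\ 0 < cond w x y, y \notin x :: past &
                  self_avoiding w m y (x :: past)]
  else True.

Lemma measurable_self_avoiding n x past :
  measurable [set w : environment d R | self_avoiding w n x past].
Proof.
elim: n x past => [|n IH] x past /=.
  by rewrite (_ : [set _ | _] = setT)//; apply/seteqP; split.
rewrite (_ : [set _ | _] =
    \bigcup_(y in [set` [seq y <- nbrs x | y \notin x :: past]])
    ([set w : environment d R | 0 < cond w x y] `&`
     [set w : environment d R | self_avoiding w n y (x :: past)])).
  apply: fin_bigcup_measurable => [|y _]; first exact: finite_seq.
  apply: measurableI => //.
  rewrite (_ : [set _ | _] = (fun w => cond w x y) @^-1` `]0, +oo[); last first.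
    by apply/seteqP; split => w /=; rewrite in_itv/= andbT.
  by rewrite -[X in measurable X]setTI; apply: measurable_cond.
apply/seteqP; split => [w [y [wy ny sy]]|w [y]] /=.
  exists y => //=; rewrite mem_filter ny mem_nbrs/=.
  by apply: contraTT wy => /(cond_eq0 w) ->; rewrite ltxx.
by rewrite mem_filter => /andP[ny _] [wy sy]; exists y.
Qed.

Lemma self_avoiding_pred w n x past :
  self_avoiding w n.+1 x past -> self_avoiding w n x past.
Proof.
elim: n x past => [//|n IH] x past [y [xy ny sy]]; exists y; split => //.
exact: IH.
Qed.

Lemma self_avoiding_le w m n x past : (m <= n)%N ->
  self_avoiding w n x past -> self_avoiding w m x past.
Proof.
move=> /subnK <-; elim: (n - m)%N => [//|k IH]; rewrite addSn.
by move=> /self_avoiding_pred.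
Qed.

(** The step of König's lemma: if each of the finitely many neighbours failed at some depth, a path
    longer than the largest of these depths could not exist. *)
Lemma self_avoiding_extend w x past : (forall n, self_avoiding w n x past) ->
  exists y, [/\ 0 < cond w x y, y \notin x :: past &
    forall n, self_avoiding w n y (x :: past)].
Proof.
move=> sx; apply: contrapT => /forallNP no.
have ex y : exists m, 0 < cond w x y -> y \notin x :: past ->
    ~ self_avoiding w m y (x :: past).
  have [wy|nwy] := boolP (0 < cond w x y); last by exists 0%N.
  have [ny|nny] := boolP (y \notin x :: past); last by exists 0%N.
  apply: contrapT => /forallNP sy; apply: (no y); split => // n.
  by apply: contrapT => nsy; apply: (sy n).
have [m mP] := choice ex.
pose M := (\max_(y <- nbrs x) m y)%N.
have [y [wy ny sy]] := sx M.+1.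
have yx : y \in nbrs x.
  rewrite mem_nbrs; apply: contraTT wy => /(cond_eq0 w) ->.
  by rewrite ltxx.
apply: (mP y wy ny); apply: self_avoiding_le sy.
by rewrite /M (big_rem y yx)/= leq_maxl.
Qed.

Lemma self_avoiding_infinite_cluster w x :
  (forall n, self_avoiding w n x [::]) -> infinite_cluster w x.
Proof.
move=> sx.
have ex (p : vertex d * seq (vertex d)) : exists y,
    (forall n, self_avoiding w n p.1 p.2) ->
    [/\ 0 < cond w p.1 y, y \notin p.1 :: p.2 &
    forall n, self_avoiding w n y (p.1 :: p.2)].
  have [sp|nsp] := pselect (forall n, self_avoiding w n p.1 p.2); last by exists 0.
  by have [y yP] := self_avoiding_extend sp; exists y.
have [g gP] := choice ex.
pose st n := iter n (fun p => (g p, p.1 :: p.2)) (x, [::]).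
have stP n : forall m, self_avoiding w m (st n).1 (st n).2.
  by elim: n => [//|n IH]; have [_ _] := gP _ IH.
have sub n k : (st n).1 \in (st (n + k.+1)%N).2.
  elim: k => [|k IH]; first by rewrite addn1 /= mem_head.
  by rewrite addnS /= inE IH orbT.
exists (fun n => (st n).1); split => //; last by move=> n; have [] := gP _ (stP n).
have neq m n : (m < n)%N -> (st m).1 <> (st n).1.
  case: n => [//|n] mn E; have [_ /negP + _] := gP _ (stP n); apply.
  rewrite -[g _]/((st n.+1).1) -E inE; move: mn; rewrite ltnS leq_eqVlt.
  case/predU1P => [->|mn]; first by rewrite eqxx.
  by have := sub m (n - m.+1)%N; rewrite addnS -addSn subnKC// => ->; rewrite orbT.
by move=> m n /= E; case: (ltngtP m n) => // /neq; rewrite E.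
Qed.

Lemma infinite_cluster_self_avoiding w x n :
  infinite_cluster w x -> self_avoiding w n x [::].
Proof.
move=> [f [f0 finj fw]].
suff sf k : self_avoiding w n (f k) [seq f i | i <- rev (iota 0 k)].
  by have := sf 0%N; rewrite f0.
elim: n k => [//|n IH] k; have past :
    f k :: [seq f i | i <- rev (iota 0 k)] = [seq f i | i <- rev (iota 0 k.+1)].
  by rewrite -addn1 iotaD rev_cat.
exists (f k.+1); split => //; rewrite past; last exact: IH.
by rewrite mem_map// mem_rev mem_iota ltnn andbF.
Qed.

(** Compactness: it presents the cluster event as a decreasing limit of measurable events, ready for
    continuity from above. *)
Lemma infinite_clusterE x : [set w : environment d R | infinite_cluster w x] =
  \bigcap_n [set w : environment d R | self_avoiding w n x [::]].
Proof.
apply/seteqP; split => w /=.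
  by move=> wx n _; exact: infinite_cluster_self_avoiding.
by move=> wx; apply: self_avoiding_infinite_cluster => n; exact: wx.
Qed.

End measurability.

(** * Independence over disjoint families of bonds *)

Section independent_events.
Variables (d : nat) (R : realType) (P : probability (environment d R) R).
Variables (J : choiceType) (beta : J -> bond d) (A : J -> set R) (q : J -> R).
Hypotheses (Piid : iid_law P) (beta_inj : injective beta)
  (mA : forall j, measurable (A j))
  (Aq : forall j, P [set w : environment d R | A j (w (beta j))] = (q j)%:E).

Definition all_in (l : seq J) : set (environment d R) :=
  [set w | forall j, j \in l -> A j (w (beta j))].

Lemma measurable_all_in l : measurable (all_in l).
Proof.
elim: l => [|j l IH].
  by rewrite (_ : all_in [::] = setT)//; exact/seteqP.
rewrite (_ : all_in (j :: l) =
    [set w : environment d R | A j (w (beta j))] `&` all_in l).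
  by apply: measurableI => //; exact: measurable_bond.
apply/seteqP; split => w /=.
  by move=> h; split=> [|i il]; apply: h; rewrite ?mem_head// inE il orbT.
by move=> [wj h] i; rewrite inE => /predU1P[->|/h].
Qed.

Lemma prob_all_in l : uniq l -> P (all_in l) = (\prod_(j <- l) q j)%:E.
Proof.
(* [iid_law] speaks of sets indexed by bonds; [B] transports [A] along [beta] and is the whole line
   at bonds outside its range. *)
move=> ul; pose F := [fset b in map beta l]%fset.
pose B b : set R := [set r | forall j, beta j = b -> A j r].
have BA j : B (beta j) = A j.
  by apply/seteqP; split => r /= h; [exact: h|move=> i /beta_inj ->].
have mB b : measurable (B b).
  have [[j <-]|nb] := pselect (exists j, beta j = b); first by rewrite BA.
  rewrite (_ : B b = setT)//; apply/seteqP; split => // r _ j jb.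
  by case: nb; exists j.
have -> : all_in l = [set w : environment d R | forall b, b \in F -> B b (w b)].
  apply/seteqP; split => w /=.
    by move=> h b; rewrite inE => /mapP[j jl ->]; rewrite BA; exact: h.
  by move=> h j jl; rewrite -BA; apply: h; rewrite inE; exact: map_f.
rewrite (Piid.2 F B mB).
have FE : perm_eq (enum_fset F) (map beta l).
  apply: uniq_perm; rewrite ?fset_uniq ?map_inj_uniq// => b.
  by rewrite -[b \in enum_fset F]/(b \in F) inE.
rewrite (perm_big _ FE) big_map/= -prodEFin; apply: eq_bigr => j _.
by rewrite BA Aq.
Qed.

Definition avoid (s : seq (seq J)) : set (environment d R) :=
  [set w | forall l, l \in s -> ~ all_in l w].

Lemma measurable_avoid s : measurable (avoid s).
Proof.
elim: s => [|l s IH].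
  by rewrite (_ : avoid [::] = setT)//; exact/seteqP.
rewrite (_ : avoid (l :: s) = ~` all_in l `&` avoid s).
  by apply: measurableI => //; apply: measurableC; exact: measurable_all_in.
apply/seteqP; split => w /=.
  by move=> h; split=> [|i il]; apply: h; rewrite ?mem_head// inE il orbT.
by move=> [wj h] i; rewrite inE => /predU1P[->|/h].
Qed.

(** The conjunction [l] is there for the induction: avoiding one more block [k] is the complement of
    realizing [k], which moves [k] from the blocks into the conjunction. Only products over
    conjunctions are thus asked of [iid_law]. *)
Lemma prob_all_in_avoid l s : uniq (l ++ flatten s) ->
  P (all_in l `&` avoid s) =
  ((\prod_(j <- l) q j) * \prod_(k <- s) (1 - \prod_(j <- k) q j))%:E.
Proof.
elim: s l => [|k s IH] l /=.
  rewrite cats0 big_nil mulr1 => ul; rewrite -prob_all_in//; congr (P _).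
  by apply/seteqP; split => [w []//|w lw]; split.
move=> ul.
have ul1 : uniq (l ++ flatten s).
  apply: subseq_uniq ul; apply: cat_subseq => //; exact: suffix_subseq.
have ul2 : uniq ((l ++ k) ++ flatten s) by rewrite -catA.
have -> : all_in l `&` avoid (k :: s) =
    (all_in l `&` avoid s) `\` (all_in (l ++ k) `&` avoid s).
  apply/seteqP; split => w /=.
    move=> [wl h]; split.
      by split => // i il; apply: h; rewrite inE il orbT.
    move=> [wlk _]; apply: (h k); first by rewrite mem_head.
    by move=> j jk; apply: wlk; rewrite mem_cat jk orbT.
  move=> [[wl ws] h]; split => // i; rewrite inE => /predU1P[->|/ws//] wk.
  apply: h; split => // j; rewrite mem_cat => /orP[]; [exact: wl|exact: wk].
have mI i : measurable (all_in i `&` avoid s).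
  by apply: measurableI; [exact: measurable_all_in|exact: measurable_avoid].
have II : (all_in l `&` avoid s) `&` (all_in (l ++ k) `&` avoid s) =
    all_in (l ++ k) `&` avoid s.
  apply/seteqP; split => [w []//|w [wlk ws]]; split => //; split => //.
  by move=> j jl; apply: wlk; rewrite mem_cat jl.
transitivity (P (all_in l `&` avoid s) - P (all_in (l ++ k) `&` avoid s))%E.
  rewrite -{2}II; apply: measureD => //.
  by rewrite (le_lt_trans (probability_le1 _ _)) ?ltry.
rewrite IH// IH// -EFinB big_cat big_cons/=; congr (_%:E); ring.
Qed.

Lemma prob_avoid s : uniq (flatten s) ->
  P (avoid s) = (\prod_(k <- s) (1 - \prod_(j <- k) q j))%:E.
Proof.
move=> us; have := prob_all_in_avoid (l := [::]) us.
rewrite big_nil mul1r => <-; congr (P _).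
by apply/seteqP; split => [w h|w []].
Qed.

End independent_events.

Lemma iid_all_in (d : nat) (R : realType) (P : probability (environment d R) R)
    (A : set R) (q : R) (l : seq (bond d)) :
  iid_law P -> measurable A ->
  (forall b, P [set w : environment d R | A (w b)] = q%:E) ->
  P (all_in id (fun=> A) l) = (q ^+ size (undup l))%:E.
Proof.
move=> Piid mA Aq; have -> : all_in id (fun=> A) l =
    all_in id (fun=> A) (undup l) :> set (environment d R).
  by apply/seteqP; split => w /= h b; have := h b; rewrite mem_undup.
rewrite (@prob_all_in _ _ P _ id (fun=> A) (fun=> q))//; last exact: undup_uniq.
by rewrite big_const_seq count_predT iter_mulr_1.
Qed.

(* Probability that two independent Bin(m, 1/2) variables differ by k. *)
Fixpoint bin_diff (R : realFieldType) (m : nat) (k : int) : R :=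
  if m is n.+1 then
    (bin_diff R n (k - 1) + 2 * bin_diff R n k + bin_diff R n (k + 1)) / 4
  else (k == 0)%:R.

(** A reflected Bin(m, 1/2) variable is again binomial up to a shift, so the difference is a Bin(2
    m, 1/2) variable minus m; here this is Pascal's rule applied twice. *)
Lemma bin_diffE (R : realFieldType) m k : bin_diff R m k =
  (if (m%:Z + k)%R is Posz j then 'C(2 * m, j) else 0)%:R / 4 ^+ m.
Proof.
elim: m k => [|m IH] k.
  by rewrite add0r expr0 divr1 /=; case: k => [[|n]|n].
rewrite /= !IH exprS invfM.
set A := (X in X%:R / _ + _ + _); set B := (X in _ + 2 * (X%:R / _) + _).
set C := (X in _ + X%:R / 4 ^+ m).
have u4 : 4 ^+ m != 0 :> R by rewrite expf_neq0.
transitivity ((A + 2 * B + C)%:R / 4 ^+ m / 4 : R); first by rewrite (natrD _ (A + 2 * B)%N) (natrD _ A) natrM; field.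
rewrite [X in _ = _ * X]mulrC mulrA; congr (_%:R / _ / _).
rewrite /A /B /C {A B C u4}.
have -> : (m%:Z + (k - 1) = m.+1%:Z + k - 2)%R by lia.
have -> : (m%:Z + k = m.+1%:Z + k - 1)%R by lia.
have -> : (m%:Z + (k + 1) = m.+1%:Z + k)%R by lia.
have -> : (2 * m.+1 = (2 * m).+2)%N by lia.
case: (m.+1%:Z + k)%R => [[|[|j]]|j] /=.
- by rewrite !bin0.
- by rewrite !bin1 bin0; lia.
- have -> : (j.+2 - (0 + 1).+1 = j)%N by lia.
  have -> : (j.+2 - 1 = j.+1)%N by lia.
  by rewrite !binS; lia.
by [].
Qed.

Lemma bin_central_max m j : ('C(2 * m, j) <= 'C(2 * m, m))%N.
Proof.
have up k : (k <= m)%N -> ('C(2 * m, k) <= 'C(2 * m, m))%N.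
  move=> km; rewrite -(subKn km); elim: (m - k)%N => [|i IH]; first by rewrite subn0.
  have [mi|im] := leqP m i.
    by rewrite (_ : m - i.+1 = m - i)%N//; apply/eqP; lia.
  apply: leq_trans IH; have -> : (m - i = (m - i.+1).+1)%N by lia.
  rewrite -(leq_pmul2l (_ : 0 < (m - i.+1).+1)%N)// mul_bin_left leq_mul2r.
  by apply/orP; right; lia.
have [jm|mj] := leqP j m; first exact: up.
have [jm|mj'] := leqP j (2 * m); last by rewrite bin_small.
by rewrite -bin_sub//; apply: up; lia.
Qed.

(** The local limit bound 'C(2 m, m) <= 4^m / sqrt (2 m + 1), squared to stay in the integers. The
    induction step reduces to (2 m + 1) (2 m + 3) <= 4 (m + 1)^2. *)
Lemma bin_central_sqr m : ((2 * m).+1 * 'C(2 * m, m) ^ 2 <= 16 ^ m)%N.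
Proof.
elim: m => [//|m IH].
have E : (m.+1 * 'C(2 * m.+1, m.+1) = 2 * (2 * m).+1 * 'C(2 * m, m))%N.
  have e1 : ((2 * m).+2 * 'C((2 * m).+1, m) = m.+1 * 'C((2 * m).+2, m.+1))%N.
    by rewrite mul_bin_diag.
  have e2 : (m.+1 * 'C((2 * m).+1, m.+1) = (2 * m).+1 * 'C(2 * m, m))%N.
    by rewrite mul_bin_diag.
  have e3 : 'C((2 * m).+1, m.+1) = 'C((2 * m).+1, m).
    by rewrite -[in LHS]bin_sub; [congr ('C(_, _)); lia|lia].
  have -> : (2 * m.+1 = (2 * m).+2)%N by lia.
  rewrite -e1 -e3; nia.
have M0 : (0 < m.+1 ^ 2)%N by rewrite expn_gt0.
rewrite -(leq_pmul2l M0) mulnCA -expnMn E (expnS 16).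
set X := ('C(2 * m, m))%N in IH *; set Y := (16 ^ m)%N in IH *.
have -> : ((2 * m.+1).+1 * (2 * (2 * m).+1 * X) ^ 2 =
  4 * ((2 * m).+1 * (2 * m).+3) * ((2 * m).+1 * X ^ 2))%N by lia.
apply: (leq_trans (leq_mul (leqnn _) IH)).
by rewrite [X in (_ <= X)%N]mulnA leq_mul2r; apply/orP; right; lia.
Qed.

Lemma bin_diff_ge0 (R : realFieldType) m k : 0 <= bin_diff R m k.
Proof. by rewrite bin_diffE divr_ge0 ?exprn_ge0. Qed.

Lemma bin_diff_sqr_le (R : realFieldType) m k :
  bin_diff R m k ^+ 2 <= ((2 * m).+1)%:R^-1.
Proof.
have le : bin_diff R m k <= 'C(2 * m, m)%:R / 4 ^+ m.
  rewrite bin_diffE ler_pM2r ?invr_gt0 ?exprn_gt0// ler_nat.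
  by case: (m%:Z + k) => j //; exact: bin_central_max.
apply: (@le_trans _ _ (('C(2 * m, m)%:R / 4 ^+ m) ^+ 2)).
  by rewrite ler_pXn2r// nnegrE ?bin_diff_ge0// divr_ge0 ?exprn_ge0.
rewrite expr_div_n [4 ^+ m ^+ 2]exprAC ler_pdivrMr ?exprn_gt0//.
rewrite ler_pdivlMl ?ltr0n//.
have := bin_central_sqr m; rewrite -(ler_nat R) natrM !natrX.
by rewrite (_ : 16 = 4 ^+ 2 :> R)//; ring.
Qed.

Definition residue_count (i t s : nat) := count (fun u => u %% 4 == i)%N (iota t s).

Lemma residue_count_ge i t s : (i < 4)%N -> (s %/ 4 <= residue_count i t s)%N.
Proof.
move=> i4; have [n] := ubnP s; elim: n s t => // n IH s t sn.
have [s4|s4] := ltnP s 4; first by rewrite divn_small.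
have sE : s = (4 + (s - 4))%N by lia.
rewrite sE /residue_count iotaD count_cat divnDl// divnn/= leq_add//.
  by case: eqP => ?; case: eqP => ?; case: eqP => ?; case: eqP => ?; lia.
by apply: IH; lia.
Qed.

(* The Green function of the walk performed by the four coordinate differences
   of two independent oriented paths, the coordinate t mod 4 moving at time t. *)
Definition green (R : realFieldType) t n (k : nat -> int) : R :=
  \sum_(s < n) \prod_(i < 4) bin_diff R (residue_count i t s) (k i).

Definition shift_coord (k : nat -> int) (j : nat) (z : int) : nat -> int :=
  fun i => if i == j then k i + z else k i.

(** First-step analysis: the term at s = 0 is the indicator of the origin, and at time t only the
    coordinate t mod 4 moves, by -1, 0 or 1 with weights 1/4, 1/2, 1/4. *)
Lemma greenS (R : realFieldType) t n k : let j := (t %% 4)%N in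
  green R t n.+1 k = \prod_(i < 4) (k i == 0)%:R +
    (green R t.+1 n (shift_coord k j (-1)) + 2 * green R t.+1 n k +
     green R t.+1 n (shift_coord k j 1)) / 4.
Proof.
move=> j; rewrite /green [LHS]big_ord_recl; congr (_ + _).
rewrite mulr_sumr -!big_split/= mulr_suml; apply: eq_bigr => s _.
have j4 : (j < 4)%N by rewrite ltn_mod.
pose jo := Ordinal j4.
rewrite [LHS](bigD1 jo)//= [X in _ = (X + _ + _) / _](bigD1 jo)//=.
rewrite [X in _ = (_ + 2 * X + _) / _](bigD1 jo)//=.
rewrite [X in _ = (_ + _ + X) / _](bigD1 jo)//= /shift_coord eqxx.
have rest z : \prod_(i < 4 | i != jo) bin_diff R (residue_count i t.+1 s)
      (if i == j :> nat then k i + z else k i) =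
    \prod_(i < 4 | i != jo) bin_diff R (residue_count i t.+1 s) (k i).
  by apply: eq_bigr => i ij; rewrite ifN.
have E : \prod_(i < 4 | i != jo) bin_diff R (residue_count i t (bump 0 s)) (k i) =
    \prod_(i < 4 | i != jo) bin_diff R (residue_count i t.+1 s) (k i).
  apply: eq_bigr => i ij; congr bin_diff.
  by rewrite /residue_count /= -/j -val_eqE/= in ij *; rewrite eq_sym (negbTE ij).
rewrite !rest E.
have -> : residue_count j t (bump 0 s) = (residue_count j t.+1 s).+1.
  by rewrite /residue_count /= -/j eqxx.
rewrite /=; ring.
Qed.

Lemma green_ge0 (R : realFieldType) t n k : 0 <= green R t n k.
Proof. by apply: sumr_ge0 => s _; apply: prodr_ge0 => i _; exact: bin_diff_ge0. Qed.

Lemma sum_inv_sqr_le (R : realFieldType) n :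
  \sum_(s < n) (s.+1%:R ^+ 2)^-1 <= 2 :> R.
Proof.
case: n => [|n]; first by rewrite big_ord0.
suff : \sum_(s < n.+1) (s.+1%:R ^+ 2)^-1 <= 2 - n.+1%:R^-1 :> R.
  by move=> /le_trans; apply; rewrite gerBl invr_ge0.
elim: n => [|n IH]; first by rewrite big_ord1 expr1n invr1; lra.
rewrite big_ord_recr/=; apply: le_trans (lerD IH (lexx _)) _.
have -> : n.+2%:R = n.+1%:R + 1 :> R by rewrite -natr1.
have n0 : 0 < n.+1%:R :> R by rewrite ltr0n.
move: n.+1%:R n0 => x x0.
rewrite -subr_ge0.
have -> : 2 - (x + 1)^-1 - (2 - x^-1 + ((x + 1) ^+ 2)^-1) = (x * (x + 1) ^+ 2)^-1.
  by field; rewrite !gt_eqF ?addr_gt0.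
by rewrite invr_ge0 mulr_ge0 ?exprn_ge0 ?addr_ge0// ltW.
Qed.

(** With M = s / 4 rounded down, each of the four coordinates has moved at least M times, so the
    product is at most (2 M + 1)^-2 <= 16 / (s + 1)^2, and the inverse squares sum to at most 2. *)
Lemma green_le32 (R : realFieldType) t n k : green R t n k <= 32.
Proof.
apply: (@le_trans _ _ (\sum_(s < n) 16 * (s.+1%:R ^+ 2)^-1)); last first.
  by rewrite -mulr_sumr; have := sum_inv_sqr_le R n; lra.
apply: ler_sum => s _; set M := (s %/ 4)%N.
have p0 : 0 <= \prod_(i < 4) bin_diff R (residue_count i t s) (k i).
  by apply: prodr_ge0 => i _; exact: bin_diff_ge0.
have M0 : 0 < (2 * M).+1%:R :> R by rewrite ltr0n.
apply: (@le_trans _ _ (((2 * M).+1%:R ^-1) ^+ 2)).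
  rewrite -(@ler_pXn2r _ 2)// ?nnegrE ?exprn_ge0 ?invr_ge0//.
  rewrite -exprM -prodrXl.
  have -> : ((2 * M).+1%:R^-1) ^+ (2 * 2) = \prod_(i < 4) (2 * M).+1%:R^-1 :> R.
    by rewrite prodr_const card_ord.
  apply: ler_prod => i _.
  rewrite sqr_ge0/=; apply: le_trans (bin_diff_sqr_le _ _ _) _.
  by rewrite lef_pV2 ?posrE// ler_nat ltnS leq_mul2l residue_count_ge.
rewrite exprVn ler_pdivlMr ?exprn_gt0// mulrC ler_pdivrMr ?exprn_gt0//.
rewrite (_ : 16 = 4 ^+ 2 :> R); last by ring.
rewrite -exprMn ler_pXn2r ?nnegrE ?mulr_ge0//.
by rewrite -natrM ler_nat /M; lia.
Qed.

(** * Oriented paths and their second moment *)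

Section oriented_paths.
Variables (d : nat) (hd : (5 <= d)%N).
Implicit Types (x y : vertex d) (s : seq bool).

Fact oriented_dir_subproof t (b : bool) : (t %% 4 + b < d)%N.
Proof. by apply: leq_trans hd; have := ltn_mod t 4; case: b; lia. Qed.

Definition oriented_dir t (b : bool) : 'I_d := Ordinal (oriented_dir_subproof t b).

Fixpoint path_bonds t x s : seq (bond d) :=
  if s is b :: s' then
    ubond x (oriented_dir t b) :: path_bonds t.+1 (x + dirv (oriented_dir t b)) s'
  else [::].

Fixpoint words n : seq (seq bool) :=
  if n is m.+1 then [seq b :: s | b <- [:: true; false], s <- words m] else [:: [::]].

Lemma big_words (R : nmodType) n (F : seq bool -> R) :
  \sum_(s <- words n.+1) F s =
  \sum_(s <- words n) F (true :: s) + \sum_(s <- words n) F (false :: s).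
Proof. by rewrite /= !big_cat/= big_nil addr0 !big_map. Qed.

Lemma size_words n s : s \in words n -> size s = n.
Proof.
elim: n s => [|n IH] s; first by rewrite inE => /eqP ->.
by move=> /allpairsP[[b s'] /= [_ /IH <- ->]].
Qed.

Lemma card_words n : size (words n) = (2 ^ n)%N.
Proof. by elim: n => [//|n IH]; rewrite size_allpairs IH expnS. Qed.

Lemma path_bonds_height t x s b : b \in path_bonds t x s ->
  exists y i, b = ubond y i /\ height x <= height y.
Proof.
elim: s t x => [//|a s IH] t x; rewrite inE => /predU1P[->|/IH].
  by exists x, (oriented_dir t a).
move=> [y [i [-> xy]]]; exists y, i; split => //; apply: le_trans xy.
by rewrite heightD height_dirv lerDl.
Qed.

Lemma path_bonds_notin t x y i s : height y < height x ->
  ubond y i \notin path_bonds t x s.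
Proof.
move=> yx; apply/negP => /path_bonds_height[z [j [/ubond_inj[<- _]]]].
by rewrite leNgt yx.
Qed.

Lemma size_path_bonds t x s : size (path_bonds t x s) = size s.
Proof. by elim: s t x => //= b s IH t x; rewrite IH. Qed.

Lemma uniq_path_bonds t x s : uniq (path_bonds t x s).
Proof.
elim: s t x => [//|b s IH] t x /=; rewrite IH andbT path_bonds_notin//.
by rewrite heightD height_dirv ltrDl.
Qed.

(** Number of distinct bonds used by the two paths, which is the exponent of p in the probability
    that both are open. *)
Definition joint_size t x x' s s' :=
  size (undup (path_bonds t x s ++ path_bonds t x' s')).

(** Later bonds start strictly higher, so the first bonds are new; they number two when the vertices
    differ, and are counted as one from a common vertex. *)
Lemma joint_size_cons t x x' b b' s s' : height x = height x' ->
  ((x != x').+1 + joint_size t.+1 (x + dirv (oriented_dir t b))%R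
     (x' + dirv (oriented_dir t b'))%R s s' <=
   joint_size t x x' (b :: s) (b' :: s'))%N.
Proof.
move=> xx'; rewrite /joint_size /=.
set l := path_bonds _ _ s; set l' := path_bonds _ _ s'.
set h := ubond x _; set h' := ubond x' _.
have hl : h \notin l ++ l'.
  by rewrite mem_cat negb_or !path_bonds_notin// !heightD !height_dirv ?xx' ltrDl.
have hl' : h' \notin l ++ l'.
  by rewrite mem_cat negb_or !path_bonds_notin// !heightD !height_dirv -?xx' ltrDl.
have E : perm_eq (h :: l ++ h' :: l') (h :: h' :: (l ++ l')).
  by rewrite perm_cons perm_catC /= perm_cons perm_catC.
have /perm_size -> := perm_undup (perm_mem E).
rewrite /= inE (negbTE hl) (negbTE hl') orbF.
case: (h =P h') => [/ubond_inj[-> _]|_] /=; first by rewrite eqxx.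
by rewrite !addSn !ltnS; case: (x != x').
Qed.

(* Directions i and i + 1 differ only on the i-th partial sum of coordinates, so
   the partial sums of the difference of two paths move one at a time. *)
Definition psi (i : nat) x : int := \sum_(j < d | (j <= i)%N) x ord0 j.

Lemma psiD i x y : psi i (x + y) = psi i x + psi i y.
Proof. by rewrite /psi -big_split; apply: eq_bigr => j _; rewrite mxE. Qed.

Lemma psi_dirv i j : psi i (dirv j) = (j <= i)%:R.
Proof.
rewrite /psi; case: leqP => ji.
  by rewrite (bigD1 j)//= dirvE eqxx big1 ?addr0// => k /andP[_ /negbTE]; rewrite dirvE => ->.
rewrite big1// => k ki; rewrite dirvE; case: eqP => // kj.
by move: ki; rewrite kj leqNgt ji.
Qed.

Definition psi_diff x x' (i : nat) : int := psi i x - psi i x'.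

Lemma psi_diff_step t b b' x x' :
  psi_diff (x + dirv (oriented_dir t b)) (x' + dirv (oriented_dir t b')) =
  shift_coord (psi_diff x x') (t %% 4) (b'%:R - b%:R).
Proof.
apply/funext => i; rewrite /psi_diff /shift_coord !psiD !psi_dirv /=.
by have [b1|b1] := leqP (t %% 4 + b) i; have [b2|b2] := leqP (t %% 4 + b') i;
  case: eqP => ij; case: b b1 => b1; case: b' b2 => b2 /=; lia.
Qed.

Lemma shift_coord0 k j : shift_coord k j 0 = k.
Proof. by apply/funext => i; rewrite /shift_coord addr0 if_same. Qed.

Variable R : realFieldType.
(* Chosen so that g <= p (1 + g) for 0 <= g <= 32, the bound on the Green
   function: this pays for a step from a common vertex. *)
Let p : R := 32 / 33.

(** Induction on the length with [greenS]. From distinct vertices a step costs p^2 and [green]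
    dominates its average. From a common vertex it costs only p, but there [green] exceeds its
    average by 1, and the choice of p makes this gain cover the missing factor. *)
Lemma joint_size_sum n t x x' : height x = height x' ->
  \sum_(s <- words n) \sum_(s' <- words n) p ^+ joint_size t x x' s s' <=
  (4 * p ^+ 2) ^+ n * (1 + green R t n (psi_diff x x')).
Proof.
have p0 : 0 <= p by rewrite /p; lra.
have p1 : p <= 1 by rewrite /p; lra.
elim: n t x x' => [|n IH] t x x' xx'.
  by rewrite /= !big_seq1 /joint_size /= mul1r lerDl green_ge0.
set c := (4 * p ^+ 2) ^+ n in IH *.
have c0 : 0 <= c by rewrite exprn_ge0 ?mulr_ge0 ?exprn_ge0.
have step b b' : \sum_(s <- words n) \sum_(s' <- words n)
      p ^+ joint_size t x x' (b :: s) (b' :: s') <=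
    p ^+ (x != x').+1 * (c * (1 + green R t.+1 n
      (shift_coord (psi_diff x x') (t %% 4) (b'%:R - b%:R)))).
  rewrite -psi_diff_step; apply: le_trans (ler_wpM2l _ (IH t.+1 _ _ _)).
  - rewrite mulr_sumr; apply: ler_sum => s _; rewrite mulr_sumr.
    apply: ler_sum => s' _; rewrite -exprD.
    by apply: ler_wiXn2l => //; exact: joint_size_cons.
  - by rewrite exprn_ge0.
  - by rewrite !heightD !height_dirv xx'.
rewrite big_words; under eq_bigr do rewrite big_words.
under [X in _ + X]eq_bigr do rewrite big_words.
rewrite !big_split/=.
apply: le_trans (lerD (lerD (step _ _) (step _ _)) (lerD (step _ _) (step _ _))) _.
rewrite !subrr shift_coord0 sub0r subr0 (exprS (4 * p ^+ 2)) -/c.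
have := greenS R t n (psi_diff x x') => /=.
have := green_le32 R t n.+1 (psi_diff x x').
have g1 := green_ge0 R t.+1 n (psi_diff x x').
have g2 := green_ge0 R t.+1 n (shift_coord (psi_diff x x') (t %% 4) (-1)).
have g3 := green_ge0 R t.+1 n (shift_coord (psi_diff x x') (t %% 4) 1).
move: (green R t n.+1 _) (green R t.+1 n _) (green R t.+1 n _) (green R t.+1 n _) g1 g2 g3.
move=> g gp gm g0 g00 gm0 gp0 g32 gE.
have [xxE|_] := eqVneq x x' => /=.
  have k0 : \prod_(i < 4) (psi_diff x x' i == 0)%:R = 1 :> R.
    by rewrite xxE big1// => i _; rewrite /psi_diff subrr eqxx.
  have -> : p ^+ false.+1 * (c * (1 + g0)) + p ^+ false.+1 * (c * (1 + gm)) +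
    (p ^+ false.+1 * (c * (1 + gp)) + p ^+ false.+1 * (c * (1 + g0))) =
    c * (p * (4 + (gm + 2 * g0 + gp))) by ring.
  have -> : 4 * p ^+ 2 * c * (1 + g) = c * (p * (p * (4 * (1 + g)))) by ring.
  rewrite k0 in gE; rewrite ler_wpM2l// ler_wpM2l//.
  have -> : gm + 2 * g0 + gp = 4 * (g - 1) by rewrite gE; field.
  by rewrite /p; lra.
have k0 : 0 <= \prod_(i < 4) (psi_diff x x' i == 0)%:R :> R by apply: prodr_ge0.
have -> : p ^+ true.+1 * (c * (1 + g0)) + p ^+ true.+1 * (c * (1 + gm)) +
    (p ^+ true.+1 * (c * (1 + gp)) + p ^+ true.+1 * (c * (1 + g0))) =
    c * (p ^+ 2 * (4 + (gm + 2 * g0 + gp))) by ring.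
have -> : 4 * p ^+ 2 * c * (1 + g) = c * (p ^+ 2 * (4 * (1 + g))) by ring.
rewrite ler_wpM2l// ler_wpM2l ?exprn_ge0//; lra.
Qed.

End oriented_paths.

Lemma open_oriented_self_avoiding (d : nat) (hd : (5 <= d)%N) (R : realType)
    (w : environment d R) s t x past :
  (forall b, b \in path_bonds hd t x s -> w b = 1 :> R) ->
  (forall y, y \in past -> height y < height x) ->
  self_avoiding w (size s) x past.
Proof.
elim: s t x past => [//|a s IH] t x past open pastx.
exists (x + dirv (oriented_dir hd t a)).
have hx : height x < height (x + dirv (oriented_dir hd t a)).
  by rewrite heightD height_dirv ltrDl.
split.
- by rewrite cond_ubond open ?mem_head// ltr01.
- apply/negP; rewrite inE => /orP[/eqP xE|/pastx].
    by move: hx; rewrite xE ltxx.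
  by rewrite ltNge ltW.
- apply: (IH t.+1) => [b bs|y]; first by rewrite open// inE bs orbT.
  by rewrite inE => /predU1P[->//|/pastx yx]; exact: lt_trans hx.
Qed.

Lemma percolation_threshold_lt1 (R : realType) (d : nat) :
  (5 <= d)%N -> percolation_threshold d R < 1.
Proof.
move=> hd; pose p : R := 32 / 33.
have p1 : p < 1 by rewrite /p; lra.
have p0 : 0 < p by rewrite /p; lra.
(* Index 0 means open and index 1 closed; larger indices have probability 0. *)
pose T k : R := if k is k'.+1 then (if k' is _.+1 then 0 else 1 - p) else 1.
have c1 : 0 <= (1 : R) <= 1 by rewrite ler01 lexx.
pose v k : conductance R :=
  if k is k'.+1 then Conductance (conductance0_subproof R) else Conductance c1.
have [||P [Piid PT]] := @iid_law_exists R d T v erefl.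
- by move=> [|[|k]] /=; lra.
- apply: cvg_near_cst; exists 2%N => // -[|[|k]] //.
have Pne1 b : P [set w : environment d R | (~` [set (1 : R)]) (w b : R)] = (1 - p)%:E.
  apply: (PT b _ 1%N); first exact: measurableC.
  move=> [|k]; first by split => // /(_ erefl).
  by split => // _ /eqP; rewrite eq_sym oner_eq0.
have P1 b : P [set w : environment d R | [set (1 : R)] (w b : R)] = p%:E.
  rewrite -[[set w | _]]setCK probability_setC; last first.
    by apply: measurableC; exact: measurable_bond.
  by rewrite [X in (_ - X)%E](Pne1 b) -EFinB opprB addrC subrK.
have P0' b : P [set w : environment d R | [set (0 : R)] (w b : R)] = (1 - p)%:E.
  apply: (PT b _ 1%N) => // -[|k] /=; split => // /eqP; rewrite oner_eq0//.
pose A s : set (environment d R) :=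
  all_in id (fun=> [set 1]) (path_bonds hd 0 (origin d) s).
have mopen s : measurable (A s) by apply: measurable_all_in => _; exact: measurable_set1.
have bound n : (33^-1%:E <= P [set w | self_avoiding w n (origin d) [::]])%E.
  pose e := (2 * p) ^+ n.
  have e0 : 0 < e by rewrite exprn_gt0 ?mulr_gt0.
  (* The number of open paths has mean e and second moment at most 33 e^2, where 33 = 1 + 32 comes
     from [green_le32]. This c maximizes 2 c e - 33 c^2 e^2, with value 1/33 for every n. *)
  have c0 : 0 <= (33 * e)^-1 by rewrite invr_ge0 mulr_ge0// ltW.
  have := @second_moment_bound _ _ _ P _ (words n) A _ c0 mopen.
  have -> : (\sum_(s <- words n) P (A s) = e%:E)%E.
    rewrite big_seq (eq_bigr (fun=> (p ^+ n)%:E)) => [|s sn]; last first.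
      rewrite (iid_all_in _ Piid (measurable_set1 1) P1).
      by rewrite undup_id ?uniq_path_bonds// size_path_bonds (size_words sn).
    rewrite -big_seq sumEFin big_const_seq iter_addr_0 count_predT card_words.
    by rewrite -[_ *+ (2 ^ n)%N]mulr_natl natrX -exprMn.
  have : (\sum_(s <- words n) \sum_(s' <- words n) P (A s `&` A s') <= (e ^+ 2 * 33)%:E)%E.
    rewrite (eq_bigr (fun s => (\sum_(s' <- words n)
        p ^+ joint_size hd 0 (origin d) (origin d) s s')%:E)) => [|s _]; last first.
      rewrite -sumEFin; apply: eq_bigr => s' _.
      rewrite -(iid_all_in _ Piid (measurable_set1 1) P1); congr (P _).
      apply/seteqP; split => w /=.
        by move=> [h h'] b; rewrite mem_cat => /orP[/h|/h'].
      by move=> h; split => b bs; apply: h; rewrite mem_cat bs ?orbT.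
    rewrite sumEFin lee_fin; apply: le_trans (joint_size_sum hd _ _ _ erefl) _.
    rewrite -/p (_ : 4 * p ^+ 2 = (2 * p) ^+ 2); last by ring.
    rewrite exprAC -/e; have := green_le32 R 0 n (psi_diff (origin d) (origin d)).
    move: (green R 0 n _) => g g32; apply: ler_wpM2l; first by rewrite exprn_ge0 ?ltW.
    by lra.
  move=> X33; set D := [set w | exists2 s, _ & _] => DX.
  have mD : measurable [set w : environment d R | self_avoiding w n (origin d) [::]].
    exact: measurable_self_avoiding.
  have DP : (P D <= P [set w | self_avoiding w n (origin d) [::]])%E.
    apply: le_measure; rewrite ?inE//.
      rewrite (_ : D = \bigcup_(s in [set` words n]) A s).
        apply: fin_bigcup_measurable => [|s _]; first exact: finite_seq.
        exact: mopen.
      by apply/seteqP; split => w [s sn As]; exists s.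
    move=> w [s /size_words <- As].
    by apply: (@open_oriented_self_avoiding _ hd _ _ _ 0%N).
  apply: le_trans DP.
  have cc : (0 <= ((33 * e)^-1 ^+ 2)%:E)%E by rewrite lee_fin exprn_ge0.
  have := le_trans DX (leeD2l _ (lee_wpmul2l cc X33)).
  rewrite -!EFinM -leeBlDr// -EFinB; apply: le_trans.
  rewrite lee_fin (_ : _ - _ = 33^-1)//.
  by field; rewrite gt_eqF.
have Pinf : (33^-1%:E <= P [set w | infinite_cluster w (origin d)])%E.
  rewrite [X in P X]infinite_clusterE.
  have cv : P [set w | self_avoiding w n (origin d) [::]] @[n --> \oo] -->
      P (\bigcap_n [set w | self_avoiding w n (origin d) [::]]).
    apply: (@nonincreasing_cvg_mu _ _ _ P
      (fun n => [set w : environment d R | self_avoiding w n (origin d) [::]])).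
    - rewrite (le_lt_trans (probability_le1 P _)) ?ltry//.
      exact: measurable_self_avoiding.
    - by move=> n; exact: measurable_self_avoiding.
    - by apply: bigcapT_measurable => n; exact: measurable_self_avoiding.
    - by apply/nonincreasing_seqP => n; apply/subsetPset => w; exact: self_avoiding_pred.
  by apply: cvge_ge cv; apply: nearW.
apply: le_lt_trans p1; apply: ge_inf.
  by exists 0 => q /= [/andP[]].
split; first by apply/andP; split; rewrite /p; lra.
exists P; last by apply: lt_le_trans Pinf; rewrite lte_fin invr_gt0.
by split => // b; split; [exact: P1|exact: P0'].
Qed.

(** * Traps *)

Section trapped_walk.
Variables (d : nat) (R : realType) (w : environment d R).
Implicit Types (x y z : vertex d) (c delta : R).

Fixpoint reach c n x y : Prop :=
  if n is m.+1 then exists2 z, c <= cond w x z & reach c m z y else x = y.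

Lemma reach_cat c m n x y z :
  reach c m x y -> reach c n y z -> reach c (m + n) x z.
Proof.
elim: m x => [|m IH] x; first by move=> ->.
by move=> [u xu uy] yz; exists u => //; exact: IH.
Qed.

Lemma reach_sym c n x y : reach c n x y -> reach c n y x.
Proof.
elim: n x => [|n IH] x; first by move=> ->.
move=> [u xu uy]; rewrite -(addn1 n); apply: reach_cat (IH _ uy) _.
by exists x; rewrite // condC.
Qed.

Lemma reach_le c c' n x y : c' <= c -> reach c n x y -> reach c' n x y.
Proof.
move=> cc; elim: n x => [//|n IH] x [u xu uy].
by exists u; [exact: le_trans xu|exact: IH].
Qed.

Definition linked c N x y := exists2 n, (n <= N)%N & reach c n x y.

Lemma linked_cat c M N x y z :
  linked c M x y -> linked c N y z -> linked c (M + N) x z.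
Proof.
move=> [m mM xy] [n nN yz]; exists (m + n)%N; first exact: leq_add.
exact: reach_cat xy yz.
Qed.

Lemma linked_le c M N x y : (M <= N)%N -> linked c M x y -> linked c N x y.
Proof. by move=> MN [n nM xy]; exists n => //; exact: leq_trans MN. Qed.

Lemma nstep_reach c n x y :
  0 <= c -> reach c n x y -> (c / (2 * d)%:R) ^+ n <= nstep w n x y.
Proof.
move=> c0; elim: n x => [|n IH] x; first by move=> ->; rewrite /= eqxx.
move=> [u xu uy]; rewrite exprS -(add1n n); apply: le_trans (nstepM _ _ _ _ u _).
have q0 : 0 <= c / (2 * d)%:R by rewrite divr_ge0.
rewrite nstep1; apply: ler_pM; rewrite ?exprn_ge0//; last exact: IH.
by apply: (le_trans _ (transition_ge w x u)); rewrite ler_wpM2r ?invr_ge0.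
Qed.

Definition trap delta x y z :=
  [/\ cond w x y = delta, cond w y z = 1,
      forall u, u != z -> cond w y u <= delta &
      forall u, u != y -> cond w z u <= delta].

(** The total conductance at y is at most 1 + 2 d delta, hence at most exp(2 d delta). *)
Lemma transition_trap delta y z : 0 <= delta -> cond w y z = 1 ->
  (forall u, u != z -> cond w y u <= delta) ->
  expR (- ((2 * d)%:R * delta)) <= transition w y z.
Proof.
move=> d0 yz yu; rewrite /transition yz mul1r expRN.
have zy : z \in nbrs y.
  rewrite mem_nbrs; apply: contraTT (ltr01 : 0 < 1 :> R) => /(cond_eq0 w).
  by rewrite yz => ->; rewrite ltxx.
have T1 : 1 <= total_cond w y.
  rewrite total_condE (big_rem _ zy)/= yz lerDl sumr_ge0// => u _.
  exact: cond_ge0.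
rewrite lef_pV2 ?posrE ?expR_gt0 ?(lt_le_trans ltr01)//.
apply: le_trans (expR_ge1Dx _).
rewrite total_condE (bigD1_seq z) ?undup_uniq//= yz lerD2l.
apply: (@le_trans _ _ (\sum_(u <- nbrs y) delta)).
  by rewrite big_mkcond/=; apply: ler_sum => u _; case: ifP => // /yu.
rewrite big_const_seq iter_addr_0 count_predT -[_ *+ _]mulr_natl.
by rewrite ler_wpM2r// ler_nat size_nbrs.
Qed.

Lemma nstep_bounce p n x y : 0 <= p -> p <= transition w x y ->
  p <= transition w y x -> (p ^+ 2) ^+ n <= nstep w (2 * n) x x.
Proof.
move=> p0 xy yx; elim: n => [|n IH]; first by rewrite /= eqxx.
rewrite mulnS exprS; apply: le_trans (nstepM _ _ _ _ x _).
apply: ler_pM; rewrite ?exprn_ge0 ?sqr_ge0//.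
apply: le_trans (nstepM _ 1 1 _ y _); rewrite !nstep1 expr2.
exact: ler_pM.
Qed.

(** One loop is followed: from o to x in l steps, through the gate, m bounces across the trapping
    bond, back through the gate, and the first l steps reversed. The same l both ways makes the
    length 2 (l + m + 1) even, so m = n - l - 1 hits time 2 n exactly. *)
Lemma nstep_trap c delta N n x y z o : (0 < d)%N -> 0 <= c <= 1 -> 0 <= delta ->
  linked c N o x -> trap delta x y z -> (N < n)%N -> n%:R * delta <= 1 ->
  (c / (2 * d)%:R) ^+ (2 * N) * (delta / (2 * d)%:R) ^+ 2 *
    expR (- (4 * d)%:R) <= nstep w (2 * n) o o.
Proof.
move=> d0 /andP[c0 c1] dl0 [l lN ox] [xy yz yu zu] Nn nd.
have lN2 : (l + l <= 2 * N)%N by lia.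
have [m nE] : exists m, n = (l + m).+1 by exists (n - l.+1)%N; lia.
have mn : (m <= n)%N by lia.
have n2E : (2 * n = l + ((1 + (2 * m + 1)) + l))%N by lia.
have q1 : c / (2 * d)%:R <= 1.
  rewrite ler_pdivrMr ?mul1r ?ltr0n ?muln_gt0//.
  by rewrite (le_trans c1)// ler1n muln_gt0.
have q0 : 0 <= c / (2 * d)%:R by rewrite divr_ge0.
set q := c / _ in q1 q0 *; set b := delta / _.
have b0 : 0 <= b by rewrite divr_ge0.
have bxy : b <= transition w x y by rewrite -xy in b b0 *; exact: transition_ge.
have byx : b <= transition w y x.
  by rewrite /b -xy condC; exact: transition_ge.
pose E := expR (- ((2 * d)%:R * delta)).
have E0 : 0 <= E by exact: expR_ge0.
have Eyz : E <= transition w y z by exact: transition_trap.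
have Ezy : E <= transition w z y by apply: transition_trap => //; rewrite condC.
have mid : b * ((E ^+ 2) ^+ m * b) <= nstep w (1 + (2 * m + 1)) x x.
  apply: le_trans (nstepM _ _ _ _ y _); rewrite nstep1.
  apply: ler_pM => //; first by rewrite mulr_ge0 ?exprn_ge0.
  apply: le_trans (nstepM _ _ _ _ y _); rewrite nstep1.
  by apply: ler_pM; rewrite ?exprn_ge0//; exact: nstep_bounce Eyz Ezy.
(* The m bounces cost exp(-4 d m delta), and m delta <= n delta <= 1. *)
have mE : expR (- (4 * d)%:R) <= (E ^+ 2) ^+ m.
  rewrite -exprM -expRM_natl ler_expR.
  rewrite mulrN lerN2 natrM mulrCA !natrM.
  have md : m%:R * delta <= 1.
    by apply: le_trans nd; rewrite ler_wpM2r// ler_nat.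
  have := ler_wpM2l (ler0n R d) md; rewrite mulr1; lra.
rewrite n2E; apply: (le_trans _ (nstepM w l _ o x o)).
apply: (@le_trans _ _ (q ^+ l * ((b * ((E ^+ 2) ^+ m * b)) * q ^+ l))).
  have -> : q ^+ l * (b * ((E ^+ 2) ^+ m * b) * q ^+ l) =
    q ^+ (l + l) * b ^+ 2 * (E ^+ 2) ^+ m by rewrite exprD; ring.
  apply: ler_pM => //; rewrite ?mulr_ge0 ?exprn_ge0 ?expR_ge0//.
  apply: ler_wpM2r; first by rewrite exprn_ge0.
  exact: ler_wiXn2l.
apply: ler_pM; rewrite ?exprn_ge0//; last 2 first.
- exact: nstep_reach.
- apply: (le_trans _ (nstepM w _ l x x o)); apply: ler_pM => //.
  + by rewrite !mulr_ge0 ?exprn_ge0.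
  + by rewrite exprn_ge0.
  + by apply: nstep_reach => //; exact: reach_sym.
by rewrite !mulr_ge0 ?exprn_ge0.
Qed.

Lemma nstep_even_gt0 (i : 'I_d) n x : (forall b : bond d, 0 < (w b : R)) ->
  0 < nstep w (2 * n) x x.
Proof.
move=> w0; pose y := x + dirv i.
have d0 : 0 < (2 * d)%:R :> R by rewrite ltr0n muln_gt0/= (leq_trans _ (ltn_ord i)).
have c0 : 0 < cond w x y by rewrite cond_ubond.
have p0 : 0 < cond w x y / (2 * d)%:R by rewrite divr_gt0.
apply: lt_le_trans (nstep_bounce n (ltW p0) (transition_ge w x y) _).
  by rewrite !exprn_gt0.
by rewrite condC; exact: transition_ge.
Qed.

End trapped_walk.

(** * Travelling along clean slabs *)

Section boxes.
Variables (d : nat) (R : realType) (w : environment d R).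
Implicit Types (x y z u lo hi : vertex d) (c : R) (a b : 'I_d).

Definition in_box lo hi x := forall i, lo ord0 i <= x ord0 i <= hi ord0 i.

Definition clean c lo hi := forall x i,
  in_box lo hi x -> in_box lo hi (x + dirv i) -> c <= (w (ubond x i) : R).

Lemma clean_le c c' lo hi : c' <= c -> clean c lo hi -> clean c' lo hi.
Proof. by move=> cc cl x i xb xib; apply: le_trans (cl _ _ xb xib). Qed.

Definition l1dist x y : nat := \sum_(i < d) absz (x ord0 i - y ord0 i).

(** Coordinates are corrected one unit at a time; each stays between those of x and y, so the path
    never leaves the box. *)
Lemma clean_reach c lo hi x y : clean c lo hi -> in_box lo hi x ->
  in_box lo hi y -> reach w c (l1dist x y) x y.
Proof.
move=> cl xb yb; move: xb; have [n] := ubnP (l1dist x y).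
elim: n x => // n IH x xn xb.
have [xy|] := pselect (forall i, x ord0 i = y ord0 i).
  have -> : x = y by apply/rowP.
  by rewrite /l1dist big1// => i _; rewrite subrr.
move=> /existsNP[i xyi].
pose e : int := if (x ord0 i < y ord0 i)%R then 1 else -1.
pose z := x + e *: dirv i.
have zi : z ord0 i = x ord0 i + e by rewrite !mxE !eqxx mulr1.
have zj j : j != i -> z ord0 j = x ord0 j.
  by move=> ji; rewrite !mxE (negbTE ji) mulr0 addr0.
have D : l1dist x y = (l1dist z y).+1.
  rewrite /l1dist (bigD1 i)//= [in RHS](bigD1 i)//= -addSn; congr (_ + _)%N.
    by rewrite zi /e; case: ltP; lia.
  by apply: eq_bigr => j ji; rewrite zj.
have zb : in_box lo hi z.
  move=> j; have [->|ji] := eqVneq j i; last by rewrite zj.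
  have := xb i; have := yb i; rewrite zi /e; case: ltP; lia.
rewrite D; exists z; last by apply: IH => //; rewrite D in xn; lia.
rewrite /z /e; case: ifP => xlty.
  rewrite scale1r cond_ubond; apply: cl => //.
  by move: zb; rewrite /z /e xlty scale1r.
have xE : x = z + dirv i.
  by rewrite /z /e xlty scaleN1r subrK.
rewrite -/e -[X in x + X *: _]/(-1); rewrite scaleN1r.
have -> : x - dirv i = z by rewrite /z /e xlty scaleN1r.
by rewrite {1}xE cond_ubondN; apply: cl => //; rewrite -xE.
Qed.

Lemma l1dist_box lo hi x y r : in_box lo hi x -> in_box lo hi y ->
  (forall i, hi ord0 i - lo ord0 i <= r%:Z) -> (l1dist x y <= d * r)%N.
Proof.
move=> xb yb hl; rewrite -[d in (d * r)%N]card_ord -sum_nat_const.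
by apply: leq_sum => i _; have := xb i; have := yb i; have := hl i; lia.
Qed.

Lemma clean_linked c lo hi x y r : clean c lo hi ->
  (forall i, hi ord0 i - lo ord0 i <= r%:Z) ->
  in_box lo hi x -> in_box lo hi y -> linked w c (d * r) x y.
Proof.
move=> cl hl xb yb; exists (l1dist x y); first exact: l1dist_box xb yb hl.
exact: clean_reach cl xb yb.
Qed.

Definition cube_hi r u : vertex d := \row_i (u ord0 i + r%:Z).

Definition slab_lo u a (s : nat) : vertex d :=
  \row_i (u ord0 i + (if i == a then s else 0%N)%:Z).

Definition slab_hi r u a (s : nat) : vertex d :=
  \row_i (u ord0 i + (if i == a then s else r)%:Z).

(** The strict bounds on [s] are for shifting the box by a unit vector: 0 < s keeps the old slab
    inside the new box, and s < r keeps the new slab inside the old one. *)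
Definition slab_ok c r u a := exists s,
  (0 < s < r)%N /\ clean c (slab_lo u a s) (slab_hi r u a s).

Definition on_slab c r u a p := exists s, [/\ (0 < s < r)%N,
  clean c (slab_lo u a s) (slab_hi r u a s) &
  in_box (slab_lo u a s) (slab_hi r u a s) p].

Lemma on_slab_cube c r u a p : on_slab c r u a p -> in_box u (cube_hi r u) p.
Proof.
move=> [s [sr _ pb]] i; have := pb i; rewrite !mxE; case: eqP => _; lia.
Qed.

(* Slabs orthogonal to distinct directions in neighbouring boxes meet. *)
Lemma on_slab_step c r u a b p i : a != b -> on_slab c r u a p ->
  slab_ok c r (u + dirv i) b ->
  exists2 p', linked w c (d * r) p p' & on_slab c r (u + dirv i) b p'.
Proof.
move=> ab [s [sr cl pb]] [s' [sr' cl']].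
(* A point of both slabs: coordinate a is fixed by the old slab, coordinate b by the new one, and
   the others are those of the lower corner of the new box. *)
pose p' : vertex d := \row_j (if j == a then u ord0 j + s%:Z else
  if j == b then (u + dirv i) ord0 j + s'%:Z else (u + dirv i) ord0 j).
have u'E j : (u + dirv i) ord0 j = u ord0 j + (j == i)%:R by rewrite mxE dirvE.
have r1 : (1 < r)%N by lia.
exists p'; last first.
  exists s'; split => // j; rewrite !mxE ?eqxx /=.
  have [->|ja] := eqVneq j a; first by rewrite (negbTE ab); case: (a == i); lia.
  by case: (j == b); case: (j == i); lia.
apply: (clean_linked cl) => // j.
  by rewrite !mxE; case: (j == a); lia.
rewrite !mxE ?eqxx /=.
have [->|ja] := eqVneq j a; first by lia.
by case: (j == b); case: (j == i); lia.
Qed.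

(** The box moves by one unit at a time and the orientation alternates between a and b, because two
    slabs of the same orientation may be parallel and disjoint. *)
Lemma on_slab_travel c r (a b : 'I_d) u x p : a != b ->
  (forall v, in_box u x v -> slab_ok c r v a /\ slab_ok c r v b) ->
  (forall i, u ord0 i <= x ord0 i) ->
  on_slab c r u a p \/ on_slab c r u b p ->
  exists2 p', linked w c (l1dist u x * (d * r)) p p' &
    on_slab c r x a p' \/ on_slab c r x b p'.
Proof.
move=> ab; have [n] := ubnP (l1dist u x); elim: n u p => // n IH u p un ok ux pu.
have [uE|] := pselect (forall i, u ord0 i = x ord0 i).
  have E : u = x by apply/rowP.
  rewrite E in pu *; exists p => //.
  by exists 0%N; rewrite // /l1dist big1// => i _; rewrite subrr.
move=> /existsNP[i uxi].
have u'E j : (u + dirv i) ord0 j = u ord0 j + (j == i)%:R by rewrite mxE dirvE.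
have D : l1dist u x = (l1dist (u + dirv i) x).+1.
  rewrite /l1dist (bigD1 i)//= [in RHS](bigD1 i)//= -addSn; congr (_ + _)%N.
    by rewrite u'E eqxx; have := ux i; lia.
  by apply: eq_bigr => j ji; rewrite u'E (negbTE ji) addr0.
have u'x j : (u + dirv i) ord0 j <= x ord0 j.
  by rewrite u'E; have := ux j; case: eqVneq => [->|_]; have := ux i; lia.
have ok' v : in_box (u + dirv i) x v -> slab_ok c r v a /\ slab_ok c r v b.
  move=> vb; apply: ok => j; have := vb j; rewrite u'E.
  by case: (j == i); lia.
have [ska skb] : slab_ok c r (u + dirv i) a /\ slab_ok c r (u + dirv i) b.
  by apply: ok' => j; rewrite lexx u'x.
have [q pq qu] : exists2 q, linked w c (d * r) p q &
    on_slab c r (u + dirv i) a q \/ on_slab c r (u + dirv i) b q.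
  case: pu => pu.
    by have [q pq qu] := on_slab_step ab pu skb; exists q => //; right.
  by rewrite eq_sym in ab; have [q pq qu] := on_slab_step ab pu ska; exists q => //; left.
have un' : (l1dist (u + dirv i)%R x < n)%N by rewrite -ltnS -D.
have [p' qp' p'x] := IH (u + dirv i) q un' ok' u'x qu.
by exists p' => //; rewrite D mulSn; exact: linked_cat pq qp'.
Qed.

(** The two extra crossings in [l1dist 0 x + 2] join the slabs to the corners 0 and x, through the
    fully clean cubes at both ends. *)
Lemma clean_path c r (a b : 'I_d) x : a != b ->
  (forall i, 0 <= x ord0 i) ->
  (forall v, in_box 0 x v -> slab_ok c r v a /\ slab_ok c r v b) ->
  clean c 0 (cube_hi r 0) -> clean c x (cube_hi r x) ->
  linked w c ((l1dist 0 x + 2) * (d * r)) 0 x.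
Proof.
move=> ab x0 ok cl0 clx.
have cube u i : cube_hi r u ord0 i - u ord0 i <= r%:Z by rewrite mxE; lia.
have ucube u : in_box u (cube_hi r u) u by move=> i; rewrite mxE; lia.
have [s [sr cls]] : slab_ok c r 0 a.
  by apply: (ok 0 _).1 => i; rewrite mxE lexx x0.
have p0 : on_slab c r 0 a (slab_lo 0 a s).
  by exists s; split => // i; rewrite !mxE; case: (i == a); lia.
have le0x i : (0 : vertex d) ord0 i <= x ord0 i by rewrite mxE.
have [p' pp' p'x] := on_slab_travel ab ok le0x (or_introl p0).
have l0 : linked w c (d * r) 0 (slab_lo 0 a s).
  by apply: (clean_linked cl0) => //; exact: on_slab_cube p0.
have l1 : linked w c (d * r) p' x.
  by apply: (clean_linked clx) => //; case: p'x; exact: on_slab_cube.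
have := linked_cat (linked_cat l0 pp') l1.
by congr (linked _ _ _ _ _); lia.
Qed.

End boxes.

(** * Probability of finding a reachable trap *)

Lemma measure_exists_le (dT : measure_display) (T : measurableType dT)
    (R : realType) (mu : {measure set T -> \bar R}) (I : eqType) (s : seq I)
    (E : I -> set T) : (forall i, measurable (E i)) ->
  measurable [set w | exists2 i, i \in s & E i w] /\
  (mu [set w | exists2 i, i \in s & E i w] <= \sum_(i <- s) mu (E i))%E.
Proof.
move=> mE; elim: s => [|i s [mIH IH]].
  rewrite (_ : [set _ | _] = set0) ?measure0 ?big_nil//.
  by apply/seteqP; split => w // [].
rewrite (_ : [set _ | _] = E i `|` [set w | exists2 i, i \in s & E i w]).
  split; first exact: measurableU.
  by rewrite big_cons; apply: le_trans (measureU2 _ _ _) _ => //; exact: leeD2l.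
apply/seteqP; split => w /=.
  by move=> [j]; rewrite inE => /predU1P[-> ?|js Ej]; [left|right; exists j].
by move=> [Ei|[j js Ej]]; [exists i; rewrite ?mem_head|exists j; rewrite // inE js orbT].
Qed.

(** * The power tail of the index law *)

Section root_tail.
Variables (R : realType) (m : nat).
Hypothesis m0 : (0 < m)%N.

Definition nat_root (n : nat) : R := n%:R `^ m%:R^-1.

Definition root_tail (k : nat) : R := (nat_root k.+1)^-1.

Lemma nat_root_gt0 n : 0 < nat_root n.+1.
Proof. by rewrite powR_gt0. Qed.

Lemma nat_rootX n : nat_root n ^+ m = n%:R.
Proof.
rewrite /nat_root -powR_mulrn ?powR_ge0// -powRrM mulVf ?powRr1//.
by rewrite pnatr_eq0 -lt0n.
Qed.

Lemma nat_root_le n (y : R) : 0 <= y -> (nat_root n <= y) = (n%:R <= y ^+ m).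
Proof. by move=> y0; rewrite -nat_rootX ler_pXn2r ?nnegrE ?powR_ge0. Qed.

Lemma le_nat_root n (y : R) : 0 <= y -> (y <= nat_root n) = (y ^+ m <= n%:R).
Proof. by move=> y0; rewrite -nat_rootX ler_pXn2r ?nnegrE ?powR_ge0. Qed.

Lemma root_tail_gt0 k : 0 < root_tail k.
Proof. by rewrite invr_gt0 nat_root_gt0. Qed.

Lemma root_tail0 : root_tail 0 = 1.
Proof. by rewrite /root_tail /nat_root powR1 invr1. Qed.

Lemma root_tail_le k l : (k <= l)%N -> root_tail l <= root_tail k.
Proof.
move=> kl; rewrite lef_pV2 ?posrE ?nat_root_gt0// le_nat_root ?powR_ge0//.
by rewrite nat_rootX ler_nat.
Qed.

Lemma root_tailX k : root_tail k ^+ m = k.+1%:R^-1.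
Proof. by rewrite exprVn nat_rootX. Qed.

Lemma root_tail_ge k y : (0 < y)%N -> (k.+1 <= y ^ m)%N -> y%:R^-1 <= root_tail k.
Proof.
move=> y0 ky; rewrite lef_pV2 ?posrE ?nat_root_gt0 ?ltr0n// nat_root_le//.
by rewrite -natrX ler_nat.
Qed.

Lemma root_tail_cvg : root_tail @ \oo --> (0 : R).
Proof.
apply/cvgrPdist_lt => e e0.
near=> k; rewrite sub0r normrN gtr0_norm ?root_tail_gt0//.
rewrite -[e]invrK ltf_pV2 ?posrE ?invr_gt0 ?nat_root_gt0//.
rewrite ltNge nat_root_le ?invr_ge0 ?(ltW e0)// -ltNge.
apply: lt_trans (_ : k%:R < _); last by rewrite ltr_nat.
by near: k; exact: nbhs_infty_gtr.
Unshelve. all: by end_near. Qed.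

(** A mean value estimate: X and X' have consecutive integers as m-th powers and are at most y, so
    X' - X >= 1 / (m y^(m-1)), and dividing by X X' <= y^2 gives the exponent m + 1. *)
Lemma root_tail_diff k y : (0 < y)%N -> (k.+2 <= y ^ m)%N ->
  (m%:R * y%:R ^+ m.+1)^-1 <= root_tail k - root_tail k.+1.
Proof.
move=> y0 ky; rewrite /root_tail.
set X := nat_root k.+1; set X' := nat_root k.+2.
have X0 : 0 < X := nat_root_gt0 _.
have X'0 : 0 < X' := nat_root_gt0 _.
have X'y : X' <= y%:R by rewrite nat_root_le// -natrX ler_nat.
have XX' : X <= X' by rewrite /X le_nat_root ?(ltW X0)// nat_rootX ler_nat.
have yR : 0 < y%:R :> R by rewrite ltr0n.
have mR : 0 < m%:R :> R by rewrite ltr0n.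
have -> : X^-1 - X'^-1 = (X' - X) / (X * X') by field; rewrite !gt_eqF.
have D : 1 <= (X' - X) * (m%:R * y%:R ^+ m.-1).
  have E1 : X' ^+ m - X ^+ m = 1 by rewrite !nat_rootX -natr1 addrC addKr.
  rewrite -[X in X <= _]E1 subrXX ler_wpM2l ?subr_ge0//.
  apply: (@le_trans _ _ (\sum_(i < m) y%:R ^+ m.-1)).
    apply: ler_sum => i _.
    have im : (m.-1 = (m.-1 - i) + i)%N by have := ltn_ord i; lia.
    rewrite [in leRHS]im exprD; apply: ler_pM; rewrite ?exprn_ge0 ?(ltW X0) ?(ltW X'0)//.
      by rewrite lerXn2r ?nnegrE// ltW.
    by rewrite lerXn2r ?nnegrE ?(le_trans XX')// ltW.
  by rewrite sumr_const card_ord mulr_natl.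
rewrite ler_pdivlMr ?mulr_gt0//.
apply: (@le_trans _ _ ((m%:R * y%:R ^+ m.+1)^-1 * y%:R ^+ 2)).
  rewrite ler_wpM2l ?invr_ge0 ?mulr_ge0 ?exprn_ge0// expr2.
  by apply: ler_pM; [exact: ltW|exact: ltW|exact: le_trans X'y|exact: X'y].
rewrite mulrC ler_pdivrMr ?mulr_gt0 ?exprn_gt0//.
have -> : (X' - X) * (m%:R * y%:R ^+ m.+1) =
    (X' - X) * (m%:R * y%:R ^+ m.-1) * y%:R ^+ 2.
  have -> : (m.+1 = m.-1 + 2)%N by lia.
  by rewrite exprD !mulrA.
by rewrite -[X in X <= _]mul1r ler_wpM2r ?exprn_ge0.
Qed.
End root_tail.

Section slab_events.
Variables (d : nat) (R : realType).
Implicit Types (u x : vertex d) (a : 'I_d).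

Definition slab_bond (K : nat) u a (s : 'I_K)
    (p : {ffun 'I_d -> 'I_K.+2} * 'I_d) : bond d :=
  ubond (\row_j (u ord0 j + (if j == a then s.+1 else p.1 j)%:Z)) p.2.

(** With r = K + 1 there are K admissible slabs, and each contains a weak bond. The function [f]
    recording their positions ranges over a finite type whose size does not depend on the scale, as
    the union bound requires. *)
Lemma not_slab_ok (w : environment d R) c K u a : ~ slab_ok w c K.+1 u a ->
  exists f : {ffun 'I_K -> {ffun 'I_d -> 'I_K.+2} * 'I_d},
    forall s, w (slab_bond u a s (f s)) < c :> R.
Proof.
move=> nok; have ex (s : 'I_K) : exists p, w (slab_bond u a s p) < c :> R.
  apply: contrapT => /forallNP nex; apply: nok; exists s.+1; split; first by have := ltn_ord s; lia.
  move=> x i xs _; rewrite leNgt; apply/negP => wc.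
  pose g : {ffun 'I_d -> 'I_K.+2} := [ffun j => inord (absz (x ord0 j - u ord0 j))].
  apply: (nex (g, i)); rewrite /slab_bond /=.
  have <- // : x = \row_j (u ord0 j + (if j == a then s.+1 else g j)%:Z).
  apply/rowP => j; rewrite !mxE ffunE; have := xs j; rewrite !mxE.
  rewrite -[x 0 j]/(x ord0 j); case: eqP => [_|_] xj; first by lia.
  by rewrite inordK; lia.
have [f fP] := choice ex.
by exists [ffun s => f s] => s; rewrite ffunE.
Qed.

Definition slab_bonds K u a (f : {ffun 'I_K -> {ffun 'I_d -> 'I_K.+2} * 'I_d}) :=
  [seq slab_bond u a s (f s) | s <- enum 'I_K].

Lemma size_undup_slab_bonds K u a (f : {ffun 'I_K -> {ffun 'I_d -> 'I_K.+2} * 'I_d}) :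
  size (undup (slab_bonds u a f)) = K.
Proof.
rewrite undup_id; first by rewrite size_map size_enum_ord.
rewrite map_inj_uniq ?enum_uniq// => s s' /ubond_inj[/rowP/(_ a)].
by rewrite !mxE eqxx => ss _; apply/val_inj => /=; lia.
Qed.

End slab_events.

(** * Geometry of a block holding a trap *)

Section trap_events.
Variables (d : nat) (R : realType) (a : 'I_d) (r L : nat).
Local Notation S := (r + 4)%N.
Local Notation offset := ({ffun 'I_d -> 'I_(r + 3).+1} * 'I_d)%type.
Local Notation site := {ffun 'I_d -> 'I_L}.

(** Blocks have side r + 4: the clean cube occupies offsets 3 to r + 3, and lower ends of bonds
    touching the trap go down to offset 0. Each bond is attached to the block of its lower end, so
    distinct blocks share no bond. *)
Definition trap_bond (j : site * offset) : bond d :=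
  ubond (\row_i (S * j.1 i + j.2.1 i)%:Z) j.2.2.

Lemma trap_bond_inj : injective trap_bond.
Proof.
move=> [q [f i]] [q' [f' i']] /ubond_inj[/rowP E /= ->].
have {}E j : (S * q j + f j = S * q' j + f' j)%N.
  by have := E j; rewrite !mxE => -[].
have S0 : (0 < S)%N by rewrite addnS.
have fS (g : {ffun 'I_d -> 'I_(r + 3).+1}) j : (g j < S)%N.
  by have := ltn_ord (g j); lia.
have qq : q = q'.
  apply/ffunP => j; apply/val_inj => /=.
  have := congr1 (divn ^~ S) (E j).
  by rewrite /= ![(S * _)%N]mulnC !divnMDl// !divn_small ?addn0.
have ff : f = f'.
  by apply/ffunP => j; apply/val_inj => /=; have := E j; rewrite qq => /addnI.
by rewrite qq ff.
Qed.

(* In the block at S * o the outer end x of the gate has offset (3, ..., 3), and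
   y = x - e_a and z = x - 2 e_a are the ends of the trapping bond; c tells
   which of y, z a bond touches and which of its ends that is. *)
Definition touch_offset (c : bool * bool) (i : 'I_d) : {ffun 'I_d -> 'I_(r + 3).+1} :=
  [ffun j => inord (3 - c.1.+1 * (j == a) - c.2 * (j == i))].

Definition is_gate (p : offset) := p == (touch_offset (false, false) a, a).
Definition is_inner (p : offset) := p == (touch_offset (true, false) a, a).
Definition is_touch (p : offset) := [exists c, p.1 == touch_offset c p.2].

(** The gate and the trapping bond also pass [is_touch], so the order of the tests matters. *)
Definition trap_set (delta : R) (p : offset) : set R :=
  if is_gate p then [set delta] else if is_inner p then [set 1] else
  if is_touch p then `]-oo, delta]%classic else [set 1].

Lemma measurable_trap_set delta p : measurable (trap_set delta p).
Proof. by rewrite /trap_set; case: ifP => // _; case: ifP => // _; case: ifP. Qed.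

Lemma touch_offsetE c i j :
  touch_offset c i j = (3 - c.1.+1 * (j == a) - c.2 * (j == i))%N :> nat.
Proof. by rewrite ffunE inordK// ltnS; lia. Qed.

Definition trap_site (o : site) : vertex d := \row_i (S * o i + 3)%:Z.

Variables (w : environment d R) (delta : R) (o : site).
Hypothesis delta0 : 0 <= delta.
Hypothesis inw : forall p, trap_set delta p (w (trap_bond (o, p))).

Let x := trap_site o.
Let y : vertex d := x - dirv a.
Let z : vertex d := y - dirv a.

Let bondE (u : vertex d) i (f : {ffun 'I_d -> 'I_(r + 3).+1}) :
  (forall j, u ord0 j = x ord0 j + (f j)%:Z - 3) -> ubond u i = trap_bond (o, (f, i)).
Proof.
move=> uE; rewrite /trap_bond /=.
suff -> : u = \row_k (S * o k + f k)%:Z by [].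
apply/rowP => j; rewrite uE !mxE /=.
by move: (S * o j)%N => t; lia.
Qed.

Let trap_le i f : is_touch (f, i) -> ~~ is_inner (f, i) ->
  w (trap_bond (o, (f, i))) <= delta :> R.
Proof.
move=> t /negbTE ni; have := inw (f, i); rewrite /trap_set t ni.
by case: ifP => _ /=; [move=> ->|rewrite in_itv/=].
Qed.

Lemma trap_block : trap w delta x y z /\ clean w 1 x (cube_hi r x).
Proof.
have touch c i : is_touch (touch_offset c i, i) by apply/existsP; exists c.
have yE j : y ord0 j = x ord0 j - (j == a)%:R.
  by rewrite /y !(mxE, eqxx).
have zE j : z ord0 j = x ord0 j - (j == a)%:R *+ 2.
  by rewrite /z mxE yE !(mxE, eqxx) /= mulr2n opprD addrA.
have yB c2 i (u : vertex d) : (forall j, u ord0 j = y ord0 j - (c2 && (j == i))%:R) ->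
    ubond u i = trap_bond (o, (touch_offset (false, c2) i, i)).
  move=> uE; apply: bondE => j; rewrite uE yE touch_offsetE /=.
  by case: c2 uE; case: (j == a); case: (j == i) => uE /=; lia.
have zB c2 i (u : vertex d) : (forall j, u ord0 j = z ord0 j - (c2 && (j == i))%:R) ->
    ubond u i = trap_bond (o, (touch_offset (true, c2) i, i)).
  move=> uE; apply: bondE => j; rewrite uE zE touch_offsetE /=.
  by case: c2 uE; case: (j == a); case: (j == i) => uE /=; lia.
(* The trapping bond is seen twice among the touching bonds, upwards from z and downwards from y;
   these are the two cases excluded in [trap]. *)
have inner c i : is_inner (touch_offset c i, i) -> i = a /\ c.1 != c.2.
  move=> /eqP[E ia]; move: E; rewrite ia => /ffunP/(_ a)/(congr1 val).
  by rewrite /= !touch_offsetE /= eqxx; case: c => -[] [].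
split; last first.
  move=> u i ub _; pose f : {ffun 'I_d -> 'I_(r + 3).+1} :=
    [ffun j => inord (absz (u ord0 j - x ord0 j) + 3)].
  have fE j : f j = (absz (u ord0 j - x ord0 j) + 3)%N :> nat.
    by rewrite ffunE inordK//; have := ub j; rewrite !mxE; lia.
  rewrite (@bondE u i f) => [|j]; last by rewrite fE; have := ub j; rewrite !mxE; lia.
  (* In direction a, the cube has offsets at least 3 and touching bonds have offsets at most 2. *)
  have nt : ~~ is_touch (f, i).
    apply/negP => /existsP[c /eqP/ffunP/(_ a)/(congr1 val)] /=.
    by rewrite fE touch_offsetE eqxx; lia.
  have ng c : ((f, i) == (touch_offset c a, a)) = false.
    by apply/negP => /eqP E; move: nt; rewrite E touch.
  by have := inw (f, i); rewrite /trap_set /is_gate /is_inner !ng (negbTE nt) => /= ->; exact: lexx.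
split.
- have {1}-> : x = y + dirv a by rewrite subrK.
  rewrite cond_ubondN (yB false) => [|j]; last by rewrite subr0.
  by have := inw (touch_offset (false, false) a, a); rewrite /trap_set /is_gate eqxx.
- have {1}-> : y = z + dirv a by rewrite subrK.
  rewrite cond_ubondN (zB false) => [|j]; last by rewrite subr0.
  have := inw (touch_offset (true, false) a, a); rewrite /trap_set.
  rewrite /is_inner eqxx; case: ifP => // /eqP[/ffunP/(_ a)/(congr1 val)].
  by rewrite /= !touch_offsetE eqxx.
- move=> u uz; have [yu|nyu] := boolP (nearest_neighbors y u); last by rewrite cond_eq0.
  have [i [uE|yuE]] := nearest_neighborsP yu.
    rewrite uE cond_ubond (yB false) => [|j]; last by rewrite subr0.
    by apply: trap_le => //; apply/negP => /inner[].
  have uE : u = y - dirv i by rewrite yuE addrK.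
  rewrite {1}yuE cond_ubondN (yB true) => [|j]; last by rewrite uE !(mxE, eqxx).
  apply: trap_le => //; apply/negP => /inner[ia _].
  by move: uz; rewrite uE ia eqxx.
move=> u uy; have [zu|nzu] := boolP (nearest_neighbors z u); last by rewrite cond_eq0.
have [i [uE|zuE]] := nearest_neighborsP zu.
  rewrite uE cond_ubond (zB false) => [|j]; last by rewrite subr0.
  apply: trap_le => //; apply/negP => /inner[ia _].
  by move: uy; rewrite uE ia subrK eqxx.
have uE : u = z - dirv i by rewrite zuE addrK.
rewrite {1}zuE cond_ubondN (zB true) => [|j]; last by rewrite uE !(mxE, eqxx).
by apply: trap_le => //; apply/negP => /inner[].
Qed.

End trap_events.

Section trap_probability.
Variables (d : nat) (R : realType) (a : 'I_d) (r : nat).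
Local Notation offset := ({ffun 'I_d -> 'I_(r + 3).+1} * 'I_d)%type.

Definition trap_weight (gate seal one : R) (p : offset) : R :=
  if is_gate a p then gate else if is_inner a p then one else
  if is_touch a p then seal else one.

Lemma card_touch : (#|[pred p : offset | is_touch a p]| <= 4 * d)%N.
Proof.
pose F (p : (bool * bool) * 'I_d) : offset := (touch_offset a r p.1 p.2, p.2).
have sub : [pred p : offset | is_touch a p] \subset [set F p | p : _].
  apply/fintype.subsetP => -[f i]; rewrite inE => /existsP[c /= /eqP ->].
  by apply/imsetP; exists (c, i).
apply: leq_trans (subset_leq_card sub) _; apply: leq_trans (leq_imset_card _ _) _.
by rewrite !card_prod !card_bool card_ord.
Qed.

(** All factors are at most 1, so overcharging is allowed: every bond pays [one], every touching
    bond also pays [seal], and the gate also pays [gate]. *)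
Lemma trap_weight_prod (gate seal one : R) :
  0 <= gate <= 1 -> 0 <= seal <= 1 -> 0 <= one <= 1 ->
  gate * seal ^+ (4 * d) * one ^+ #|{: offset}| <=
    \prod_(p : offset) trap_weight gate seal one p.
Proof.
move=> /andP[g0 g1] /andP[s0 s1] /andP[u0 u1].
pose G (p : offset) := if is_gate a p then gate else 1.
pose T (p : offset) := if is_touch a p then seal else 1.
have GE : \prod_p G p = gate.
  by rewrite /G -big_mkcond /= big_pred1_eq.
have TE : seal ^+ (4 * d) <= \prod_p T p.
  rewrite /T -big_mkcond/= prodr_const; apply: ler_wiXn2l => //.
  exact: card_touch.
have G0 p : 0 <= G p <= 1 by rewrite /G; case: ifP => _; rewrite ?g0 ?g1 ?lexx ?ler01.
have T0 p : 0 <= T p <= 1 by rewrite /T; case: ifP => _; rewrite ?s0 ?s1 ?lexx ?ler01.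
apply: (@le_trans _ _ (\prod_p (G p * T p * one))).
  rewrite !big_split/= GE prodr_const; apply: ler_wpM2r; first by rewrite exprn_ge0.
  exact: ler_wpM2l.
apply: ler_prod => p _; have /andP[Gp0 Gp1] := G0 p; have /andP[Tp0 Tp1] := T0 p.
have GT0 : 0 <= G p * T p by rewrite mulr_ge0.
have GT1 : G p * T p <= 1 by rewrite mulr_ile1.
rewrite !mulr_ge0//= /trap_weight; case: ifPn => gp.
  have -> : G p = gate by rewrite /G gp.
  by rewrite -mulrA ler_piMr// mulr_ile1.
case: ifP => _; first by rewrite ler_piMl.
have G1 : G p = 1 by rewrite /G (negbTE gp).
rewrite G1 mul1r; case: ifPn => tp; first by rewrite /T tp -[X in _ <= X]mulr1 ler_wpM2l.
by rewrite -[X in _ <= X]mul1r ler_wpM2r.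
Qed.

End trap_probability.

Lemma borel_cantelli_sqr (dT : measure_display) (T : measurableType dT)
    (R : realType) (P : probability T R) (F : nat -> set T) (C : R) :
  0 <= C -> (forall k, measurable (F k)) ->
  (forall k, (P (F k) <= (C / k.+1%:R ^+ 2)%:E)%E) ->
  {ae P, forall w, exists k0, forall k, (k0 <= k)%N -> ~ F k w}.
Proof.
move=> C0 mF FC; exists (lim_sup_set F); split.
- by apply: bigcap_measurable => // n _; exact: bigcup_measurable.
- apply: lim_sup_set_cvg0 => //; apply: (@le_lt_trans _ _ (C * 2)%:E); last exact: ltry.
  apply: lime_le; first by apply: is_cvg_nneseries.
  apply: nearW => n; rewrite big_mkord.
  apply: le_trans (lee_sum _ (fun (k : 'I_n) _ => FC k)) _.
  by rewrite sumEFin lee_fin -mulr_sumr ler_wpM2l// sum_inv_sqr_le.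
move=> w /= nex n _; apply: contrapT => nF; apply: nex; exists n => k nk Fk.
by apply: nF; exists k.
Qed.

(** From exp(x / n) >= x / n; it trades exponential decay in y for the power y^(-2 m) that is
    summable in k. *)
Lemma expRN_le (R : realType) (x : R) n : (0 < n)%N -> 0 < x ->
  expR (- x) <= (n%:R / x) ^+ n.
Proof.
move=> n0 x0; have nR : 0 < n%:R :> R by rewrite ltr0n.
rewrite expRN -[_ / x]invrK exprVn lef_pV2 ?posrE ?expR_gt0 ?exprn_gt0 ?invr_gt0 ?divr_gt0//.
have -> : expR x = expR (x / n%:R) ^+ n.
  by rewrite -expRM_natl mulrCA divff ?mulr1 ?gt_eqF.
rewrite invf_div lerXn2r ?nnegrE ?expR_ge0 ?divr_ge0 ?(ltW x0)//.
by apply: le_trans (expR_ge1Dx _); rewrite lerDr.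
Qed.

Section bad_events.
Variables (R : realType) (d : nat) (T v : nat -> R)
  (P : probability (environment d R) R).
Hypotheses (v1 : v 0%N = 1) (v_decr : forall k, v k.+1 < v k).
Hypotheses (Piid : iid_law P)
  (PT : forall (b : bond d) (A : set R) i, measurable A ->
    (forall k, A (v k) <-> (i <= k)%N) ->
    P [set w : environment d R | A (w b)] = (T i)%:E).

Lemma v_lt k l : (v k < v l) = (l < k)%N.
Proof.
have mono : {homo v : k l / (k < l)%N >-> l < k}.
  apply: (@homo_ltn R v (fun x y : R => y < x)) => // y x z h1 h2.
    exact: lt_trans h2 h1.
by case: (ltngtP l k) => [/mono//|/mono kl|->]; [rewrite ltNge ltW|rewrite ltxx].
Qed.

Lemma v_le k l : (v k <= v l) = (l <= k)%N.
Proof. by rewrite leNgt v_lt -leqNgt. Qed.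

Lemma prob_lt b g :
  P [set w : environment d R | `]-oo, v g[%classic (w b : R)] = (T g.+1)%:E.
Proof. by apply: PT => // k; rewrite /= in_itv/= v_lt. Qed.

Lemma prob_le b k :
  P [set w : environment d R | `]-oo, v k]%classic (w b : R)] = (T k)%:E.
Proof. by apply: PT => // l; rewrite /= in_itv/= v_le. Qed.

Lemma prob_eq b k :
  P [set w : environment d R | [set v k] (w b : R)] = (T k - T k.+1)%:E.
Proof.
have -> : [set w : environment d R | [set v k] (w b : R)] =
    [set w : environment d R | `]-oo, v k]%classic (w b : R)] `\`
    [set w : environment d R | (`]-oo, v k] `\ v k)%classic (w b : R)].
  apply/seteqP; split => w /=.
    by move=> ->; rewrite in_itv/= lexx; split => // -[].
  by move=> [wk nw]; apply: contrapT => wv; apply: nw.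
have mD : measurable (`]-oo, v k] `\ v k : set R) by exact: measurableD.
transitivity (P [set w : environment d R | `]-oo, v k]%classic (w b : R)] -
  P [set w : environment d R | (`]-oo, v k] `\ v k)%classic (w b : R)])%E.
  rewrite measureD; last 3 first.
  - exact: measurable_bond.
  - exact: measurable_bond.
  - by rewrite [X in (X < _)%E](prob_le b k) ltry.
  by congr (_ - P _)%E; apply/seteqP; split => [w []//|w wb]; split => //; exact: wb.1.
rewrite prob_le (PT b (i := k.+1)) ?EFinB// => l /=.
rewrite in_itv/= v_le; split => [[kl lk]|kl]; last first.
  by split; [exact: ltnW|move=> /eqP; rewrite eq_le !v_le (leqNgt l) kl andbF].
rewrite ltn_neqAle kl andbT; apply/eqP => E; apply: lk; by rewrite E.
Qed.

Variables (a0 a1 : 'I_d) (K : nat).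
Hypothesis a01 : a0 != a1.

Definition nat_vertex n (u : {ffun 'I_d -> 'I_n}) : vertex d := \row_j (u j)%:Z.

Local Notation slab_code n :=
  ({ffun 'I_d -> 'I_n.+1} * bool *
   {ffun 'I_K -> {ffun 'I_d -> 'I_K.+2} * 'I_d})%type.

Definition blocked (g n : nat) (i : slab_code n) : set (environment d R) :=
  [set w | forall b, b \in slab_bonds (nat_vertex i.1.1) (if i.1.2 then a0 else a1) i.2 ->
    `]-oo, v g[%classic (w b : R)].

Definition bad_slabs g n : set (environment d R) :=
  [set w | exists2 i : slab_code n, i \in enum {: slab_code n} & blocked g i w].

Lemma bad_slabs_le g n : measurable (bad_slabs g n) /\
  (P (bad_slabs g n) <= (#|{: slab_code n}|%:R * T g.+1 ^+ K)%:E)%E.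
Proof.
have mb i : measurable (@blocked g n i).
  apply: (@measurable_all_in d R _ id (fun=> `]-oo, v g[%classic)) => _.
  exact: measurable_itv.
have [mE PE] := measure_exists_le P (enum {: slab_code n}) mb.
split => //; apply: le_trans PE _.
rewrite (eq_bigr (fun=> (T g.+1 ^+ K)%:E)) => [|i _]; last first.
  have := iid_all_in (slab_bonds (nat_vertex i.1.1) (if i.1.2 then a0 else a1) i.2)
    Piid (measurable_itv `]-oo, v g[) (prob_lt ^~ g).
  by rewrite size_undup_slab_bonds.
by rewrite sumEFin big_const_seq iter_addr_0 count_predT -cardE mulr_natl.
Qed.

Lemma slabs_ok (w : environment d R) g n x : ~ bad_slabs g n w ->
  in_box 0 (\row_j n%:Z) x -> slab_ok w (v g) K.+1 x a0 /\ slab_ok w (v g) K.+1 x a1.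
Proof.
move=> nb xb; pose u : {ffun 'I_d -> 'I_n.+1} := [ffun j => inord (absz (x ord0 j))].
have xE : x = nat_vertex u.
  apply/rowP => j; rewrite mxE ffunE -[x 0 j]/(x ord0 j).
  by have := xb j; rewrite !mxE => xj; rewrite inordK; lia.
suff ok t : slab_ok w (v g) K.+1 x (if t then a0 else a1).
  by split; [exact: (ok true)|exact: (ok false)].
apply: contrapT => /not_slab_ok[f wf]; apply: nb; exists (u, t, f).
  by rewrite mem_enum.
by move=> b /mapP[s _ ->] /=; rewrite in_itv/= -xE; exact: wf.
Qed.

Variable L : nat.
Hypothesis T0 : T 0%N = 1.

Local Notation site := {ffun 'I_d -> 'I_L}.
Local Notation offset := ({ffun 'I_d -> 'I_(K.+1 + 3).+1} * 'I_d)%type.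

Definition no_trap k : set (environment d R) :=
  avoid (fun j : site * offset => @trap_bond d K.+1 L j)
    (fun j => trap_set a0 (v k) j.2)
    [seq [seq (o, p) | p <- enum {: offset}] | o <- enum {: site}].

Lemma measurable_no_trap k : measurable (no_trap k).
Proof. by apply: measurable_avoid => j; exact: measurable_trap_set. Qed.

(** Different blocks use different bonds, so their failures multiply. Conductance 1 is index 0, of
    probability [1 - T 1]. *)
Lemma prob_no_trap k : P (no_trap k) =
  ((1 - \prod_(p : offset) trap_weight a0 (T k - T k.+1) (T k) (1 - T 1%N) p)
    ^+ (L ^ d))%:E.
Proof.
rewrite /no_trap (@prob_avoid _ _ P _ _ _
  (fun j => trap_weight a0 (T k - T k.+1) (T k) (1 - T 1%N) j.2)) //; first last.
- rewrite -[flatten _]/[seq (o, p) | o <- enum {: site}, p <- enum {: offset}].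
  by apply: allpairs_uniq; rewrite ?enum_uniq// => -[? ?] [? ?].
- move=> [q p] /=; rewrite /trap_set /trap_weight.
  case: ifP => _; first exact: prob_eq.
  have P1 := prob_eq (trap_bond (q, p)) 0; rewrite v1 T0 in P1.
  by case: ifP => _ //; case: ifP => _ //; exact: prob_le.
- by move=> j; exact: measurable_trap_set.
- exact: trap_bond_inj.
rewrite big_map (eq_bigr (fun=> 1 - \prod_(p : offset)
    trap_weight a0 (T k - T k.+1) (T k) (1 - T 1%N) p)) => [|o _]; last first.
  by rewrite big_map big_enum.
by rewrite big_enum/= prodr_const card_ffun !card_ord.
Qed.

Lemma not_no_trap w k : ~ no_trap k w -> exists o : site,
  forall p, trap_set a0 (v k) p (w (@trap_bond d K.+1 L (o, p)) : R).
Proof.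
move=> nt; apply: contrapT => /forallNP no; apply: nt => l /mapP[q _ ->] lq.
apply: (no q) => p; apply: (lq (q, p)).
by apply/mapP; exists p; rewrite ?mem_enum.
Qed.

End bad_events.

(** Least y with y^m >= k + 2; the search succeeds since k + 2 itself qualifies when m > 0. The 2
    accommodates [root_tail k.+1], which is (k + 2)^(-1/m). *)
Definition ceil_root (m k : nat) : nat :=
  find (fun y => k.+2 <= y ^ m)%N (iota 0 k.+3).

Lemma ceil_rootP m k : (0 < m)%N ->
  (k.+2 <= ceil_root m k ^ m)%N /\ ((ceil_root m k).-1 ^ m < k.+2)%N.
Proof.
move=> m0; pose q y := (k.+2 <= y ^ m)%N.
have hq : has q (iota 0 k.+3).
  apply/hasP; exists k.+2; first by rewrite mem_iota leq0n add0n /=.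
  by rewrite /q -{1}(expn1 k.+2) leq_pexp2l.
have lt : (ceil_root m k < k.+3)%N by move: hq; rewrite has_find size_iota.
split; first by have := nth_find 0%N hq; rewrite nth_iota ?add0n.
case E : (ceil_root m k) => [|y]; first by rewrite exp0n.
have := @before_find _ 0%N q (iota 0 k.+3) y; rewrite -[find _ _]/(ceil_root m k) E.
move=> /(_ (ltnSn y)); rewrite nth_iota ?add0n; last first.
  by apply: ltn_trans lt; rewrite E.
by rewrite /q => h; rewrite ltnNge h.
Qed.

Definition trapped (d : nat) (R : realType) (w : environment d R) (c delta : R)
    (N : nat) := exists x y z, linked w c N (origin d) x /\ trap w delta x y z.

(** A conductance below every [v g] has probability at most every [T g.+1], hence 0, and there are
    countably many bonds. *)
Lemma ae_conductance_ge (d : nat) (R : realType) (P : probability (environment d R) R)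
    (T v : nat -> R) : T @ \oo --> (0 : R) ->
  (forall b g, P [set w : environment d R | `]-oo, v g[%classic (w b : R)] =
    (T g.+1)%:E) ->
  {ae P, forall w : environment d R, forall b, exists g, v g <= (w b : R)}.
Proof.
move=> T0 PT.
have ae1 b : {ae P, forall w : environment d R, exists g, v g <= (w b : R)}.
  pose N := \bigcap_g [set w : environment d R | `]-oo, v g[%classic (w b : R)].
  have mN : measurable N.
    by apply: bigcapT_measurable => g; apply: measurable_bond.
  exists N; split => //.
    apply/eqP; rewrite eq_le measure_ge0 andbT.
    have T0' : (fun g => T g.+1) @ \oo --> (0 : R) by rewrite (cvg_shiftS T).
    have nf : \forall g \near \oo, (T g.+1)%:E \is a fin_num by apply: nearW => g.
    apply: (cvge_ge _ (cvg_EFin nf T0')).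
    apply: nearW => g; rewrite -(PT b); apply: le_measure; rewrite ?inE//.
      exact: measurable_bond.
    by move=> w; apply.
  move=> w /= nex g _ /=; rewrite in_itv/= ltNge; apply/negP => vg.
  by apply: nex; exists g.
pose Q n (w : environment d R) :=
  if choice.unpickle n is Some b then exists g, v g <= (w b : R) else True.
have aeQ : {ae P, forall w, forall n, Q n w}.
  apply: ae_foralln => n; rewrite /Q; case: choice.unpickle => [b|]; first exact: ae1.
  exact: aeW.
apply: filterS aeQ => w Qw b.
by have := Qw (choice.pickle b); rewrite /Q choice.pickleK.
Qed.

(** * Exponents and error estimates *)

Section trap_law.
Variables (R : realType) (d m e : nat).
Hypotheses (hd : (5 <= d)%N) (m0 : (0 < m)%N) (em : (m + 2 + 4 * d <= d * e)%N).

Local Notation T := (root_tail R m).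
Local Notation yk k := (ceil_root m k).

Lemma ceil_root_gt0 k : (0 < yk k)%N.
Proof.
have [+ _] := ceil_rootP k m0; case: (yk k) => [|//].
by rewrite exp0n.
Qed.

Lemma ceil_root_inv_sqr k :
  ((yk k)%:R ^+ (2 * m))^-1 <= (k.+1%:R ^+ 2)^-1 :> R.
Proof.
have [ky _] := ceil_rootP k m0.
rewrite lef_pV2 ?posrE ?exprn_gt0 ?ltr0n ?ceil_root_gt0//.
rewrite mulnC exprM -natrX -!natrX ler_nat leq_exp2r//.
exact: leq_trans ky.
Qed.

(** Since T (y+1)^m <= 1/y, spoiling this many slabs has probability at most y^-(d e + 2 m): the
    part y^(-d e) pays for the number of sub-boxes, and the part y^(-2 m) is at most (k + 1)^-2. *)
Definition slab_order := (m * (d * e + 2 * m))%N.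
Local Notation K := slab_order.
Local Notation S := (K.+1 + 4)%N.

Definition slab_const : R := ((S.+1 ^ d) * 2 * ((K.+2 ^ d * d) ^ K))%:R.

Lemma slab_prob_le k y : y = yk k ->
  #|{: {ffun 'I_d -> 'I_(S * y ^ e).+1} * bool *
       {ffun 'I_K -> {ffun 'I_d -> 'I_K.+2} * 'I_d}}|%:R * T y.+1 ^+ K <=
  slab_const / k.+1%:R ^+ 2.
Proof.
move=> yE; have y0 : (0 < y)%N by rewrite yE ceil_root_gt0.
have yR : 0 < y%:R :> R by rewrite ltr0n.
rewrite !card_prod !card_ffun !card_prod !card_ffun card_bool !card_ord.
rewrite /slab_const.
apply: (@le_trans _ _ (((S.+1 * y ^ e) ^ d * 2 * (K.+2 ^ d * d) ^ K)%:R *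
    (y%:R ^+ (d * e + 2 * m))^-1)).
  apply: ler_pM => //.
  - by rewrite exprn_ge0// ltW// root_tail_gt0.
  - rewrite ler_nat !leq_mul2r leq_exp2r ?(leq_trans _ hd)//.
    by apply/orP; right; apply/orP; right; rewrite mulSn -add1n leq_add2r expn_gt0 y0.
  rewrite /slab_order exprM root_tailX// exprVn lef_pV2 ?posrE ?exprn_gt0//.
  by rewrite lerXn2r ?nnegrE// ler_nat; lia.
rewrite expnMn -expnM (mulnC e d) exprD invfM.
rewrite -!mulnA [in X in X <= _]mulnCA natrM natrX.
have -> : forall A B C : R, A * B * (A^-1 * C) = (A / A) * (B * C).
  by move=> A B C; rewrite mulrACA.
rewrite divff ?mul1r ?expf_neq0 ?gt_eqF//.
by apply: ler_wpM2l => //; rewrite yE ceil_root_inv_sqr.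
Qed.

Local Notation offset := ({ffun 'I_d -> 'I_(K.+1 + 3).+1} * 'I_d)%type.

Definition trap_scale : R := (1 - T 1%N) ^+ #|{: offset}| / m%:R.

Lemma root_tail1_lt1 : T 1%N < 1.
Proof.
rewrite ltNge; apply/negP => h; have := exprn_ege1 m h.
by rewrite root_tailX// leNgt invf_lt1 ?ltr1n ?ltr0n.
Qed.

Lemma trap_scale_gt0 : 0 < trap_scale.
Proof.
by rewrite divr_gt0 ?ltr0n// exprn_gt0// subr_gt0 root_tail1_lt1.
Qed.

Definition trap_const : R := ((2 * m)%:R / trap_scale) ^+ (2 * m).

(** A block succeeds with probability Pi >= [trap_scale] / y^(m + 1 + 4 d), so y^(d e) blocks all
    fail with probability at most exp(- [trap_scale] y), the hypothesis on e leaving one spare power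
    of y. Then [expRN_le] applies with exponent 2 m. *)
Lemma trap_prob_le (a : 'I_d) k y : y = yk k ->
  (1 - \prod_(p : offset) trap_weight a (T k - T k.+1) (T k) (1 - T 1%N) p)
    ^+ ((y ^ e) ^ d) <= trap_const / k.+1%:R ^+ 2.
Proof.
move=> yE; have y0 : (0 < y)%N by rewrite yE ceil_root_gt0.
have [ky _] := ceil_rootP k m0; rewrite -yE in ky.
have yR : 0 < y%:R :> R by rewrite ltr0n.
have T01 l : 0 <= T l <= 1.
  by rewrite ltW ?root_tail_gt0//= -(root_tail0 R m) root_tail_le.
have /andP[Tk0 Tk1] := T01 k; have /andP[Ts0 Ts1] := T01 k.+1.
have g01 : 0 <= T k - T k.+1 <= 1.
  by rewrite subr_ge0 root_tail_le//= lerBlDr (le_trans Tk1)// lerDl.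
have u01 : 0 <= 1 - T 1%N <= 1.
  by have /andP[? ?] := T01 1%N; rewrite subr_ge0 gerBl; apply/andP.
set Pi := \prod_(p : offset) _.
have Pi1 : Pi <= 1.
  apply: (@le_trans _ _ (\prod_(p : offset) 1)); last by rewrite big1.
  apply: ler_prod => p _; rewrite /trap_weight.
  by case: ifP => // _; case: ifP => // _; case: ifP.
have Pige : trap_scale / y%:R ^+ (m + 1 + 4 * d) <= Pi.
  apply: le_trans (trap_weight_prod a K.+1 g01 (T01 k) u01).
  apply: (@le_trans _ _ ((m%:R * y%:R ^+ m.+1)^-1 * (y%:R^-1) ^+ (4 * d) *
      (1 - T 1%N) ^+ #|{: offset}|)).
    rewrite /trap_scale exprVn addn1 exprD.
    have B0 : y%:R ^+ m.+1 != 0 :> R by rewrite expf_neq0 ?gt_eqF.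
    have C0 : y%:R ^+ (4 * d) != 0 :> R by rewrite expf_neq0 ?gt_eqF.
    have mR0 : m%:R != 0 :> R by rewrite pnatr_eq0 -lt0n.
    move: (y%:R ^+ m.+1) (y%:R ^+ (4 * d)) ((1 - T 1%N) ^+ _) m%:R B0 C0 mR0.
    move=> B C A M B0 C0 M0; rewrite le_eqVlt; apply/orP; left; apply/eqP.
    by field; rewrite M0 B0 C0.
  rewrite ler_wpM2r ?exprn_ge0//; first by case/andP: u01.
  apply: ler_pM; rewrite ?exprn_ge0 ?invr_ge0 ?mulr_ge0 ?exprn_ge0//.
    by apply: root_tail_diff.
  have yT : y%:R^-1 <= T k by apply: root_tail_ge => //; exact: ltnW.
  have yV0 : 0 <= y%:R^-1 :> R by rewrite invr_ge0.
  by rewrite lerXn2r ?nnegrE.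
have c0 := trap_scale_gt0.
apply: (@le_trans _ _ (expR (- Pi) ^+ ((y ^ e) ^ d))).
  rewrite lerXn2r ?nnegrE ?subr_ge0 ?expR_ge0//.
  exact: expR_ge1Dx.
rewrite -expRM_natl mulrN.
have em' : ((m + 1 + 4 * d).+1 <= e * d)%N by rewrite (mulnC e) -addSn -addnS.
have big : trap_scale * y%:R <= ((y ^ e) ^ d)%:R * Pi.
  apply: (@le_trans _ _ (((y ^ e) ^ d)%:R * (trap_scale / y%:R ^+ (m + 1 + 4 * d)))).
    rewrite mulrCA ler_wpM2l ?(ltW c0)// ler_pdivlMr ?exprn_gt0//.
    rewrite -exprS -natrX ler_nat -expnM leq_pexp2l//.
  by rewrite ler_wpM2l.
apply: (@le_trans _ _ (expR (- (trap_scale * y%:R)))); first by rewrite ler_expR lerN2.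
have m20 : (0 < 2 * m)%N by rewrite muln_gt0.
apply: le_trans (expRN_le m20 (mulr_gt0 c0 yR)) _.
rewrite invfM mulrA expr_div_n /trap_const ler_wpM2l//.
  by rewrite exprn_ge0// divr_ge0// ltW.
by rewrite yE ceil_root_inv_sqr.
Qed.

End trap_law.

(** The walk starts at a prescribed vertex, whose cube cannot be chosen; its finitely many bonds
    still have a positive minimum, which [v y] undercuts at large scales. *)
Lemma eventually_clean (d : nat) (R : realType) (w : environment d R)
    (v : nat -> R) r : (forall k l, (k <= l)%N -> v l <= v k) ->
  (forall b, exists g, v g <= (w b : R)) ->
  exists g, clean w (v g) 0 (cube_hi r (origin d)).
Proof.
move=> vni wv; have [g gP] := choice wv.
pose G := (\max_(p : {ffun 'I_d -> 'I_r.+1} * 'I_d) g (ubond (nat_vertex p.1) p.2))%N.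
exists G => x i xb _; pose f : {ffun 'I_d -> 'I_r.+1} := [ffun j => inord (absz (x ord0 j))].
have xE : x = nat_vertex f.
  apply/rowP => j; rewrite mxE ffunE -[x 0 j]/(x ord0 j).
  by have := xb j; rewrite !mxE => xj; rewrite inordK; lia.
apply: le_trans (gP _); apply: vni; rewrite xE.
exact: (@leq_bigmax _ (fun p => g (ubond (nat_vertex p.1) p.2)) (f, i)).
Qed.

(* The witness gives each bond the conductance v I with P (I >= k) = root_tail k. *)
Lemma trap_law_exists (R : realType) (d m e : nat) : (5 <= d)%N -> (0 < m)%N ->
  (m + 2 + 4 * d <= d * e)%N -> exists D : nat, forall v : nat -> R,
  v 0%N = 1 -> (forall k, v k.+1 < v k) -> (forall k, 0 < v k) ->
  exists P : probability (environment d R) R, iid_law P /\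
    {ae P, forall w : environment d R, (forall b, 0 < (w b : R)) /\
      exists k0, forall k, (k0 <= k)%N ->
        trapped w (v (ceil_root m k)) (v k) (D * ceil_root m k ^ e)}.
Proof.
move=> hd m0 em; pose K := slab_order d m e; pose r := K.+1.
pose S := (K.+1 + 4)%N; exists ((d * S + 2) * (d * r))%N => v v1 vdecr v0.
pose T := root_tail R m.
have d0 : (0 < d)%N by exact: leq_trans hd.
have d1 : (1 < d)%N by exact: leq_trans hd.
pose a0 : 'I_d := Ordinal d0; pose a1 : 'I_d := Ordinal d1.
have a01 : a0 != a1 by [].
have vmono k l : (k <= l)%N -> v l <= v k by rewrite v_le.
have v01 k : 0 <= v k <= 1 by rewrite ltW//= -v1 vmono.
pose vc k := Conductance (v01 k).
have Tni k : T k.+1 <= T k by apply: root_tail_le.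
have [P [Piid PTc]] := iid_law_exists d vc (root_tail0 R m) Tni (@root_tail_cvg R m m0).
have PT (b : bond d) (A : set R) i : measurable A ->
    (forall k, A (v k) <-> (i <= k)%N) ->
    P [set w : environment d R | A (w b)] = (T i)%:E by exact: PTc.
exists P; split => //.
pose L k := (ceil_root m k ^ e)%N.
pose F k := bad_slabs v a0 a1 K (ceil_root m k) (S * L k) `|`
  no_trap v a0 K (L k) k.
have mF k : measurable (F k).
  apply: measurableU; last exact: measurable_no_trap.
  exact: (bad_slabs_le vdecr Piid PT _ _ _ _ _).1.
have FC k : (P (F k) <= ((slab_const R d m e + trap_const R d m e) / k.+1%:R ^+ 2)%:E)%E.
  have [mB PB] := bad_slabs_le vdecr Piid PT a0 a1 K (ceil_root m k) (S * L k).
  apply: le_trans (measureU2 _ mB (measurable_no_trap _ _ _ _ _)) _.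
  rewrite mulrDl EFinD; apply: leeD.
    by apply: le_trans PB _; rewrite lee_fin; exact: slab_prob_le.
  rewrite [X in (X <= _)%E](prob_no_trap v1 vdecr Piid PT a0 K (L k) (root_tail0 R m)).
  by rewrite lee_fin; exact: trap_prob_le.
have C0 : 0 <= slab_const R d m e + trap_const R d m e.
  by rewrite addr_ge0// exprn_ge0// divr_ge0// ltW// trap_scale_gt0.
have ae1 := borel_cantelli_sqr C0 mF FC.
have ae2 := ae_conductance_ge (@root_tail_cvg R m m0) (prob_lt vdecr PT).
apply: filterS2 ae1 ae2 => w [k1 nF] wv; split.
  by move=> b; have [g gb] := wv b; exact: lt_le_trans gb.
have [g0 cl0] := eventually_clean r vmono wv.
(* Beyond g0^m the root y exceeds g0, so the cube at the origin is clean at level [v y]. *)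
exists (maxn k1 (g0 ^ m))%N => k; rewrite geq_max => /andP[k1k g0k].
have [ky _] := ceil_rootP k m0; set y := ceil_root m k in ky *.
have y0 : (0 < y)%N by exact: ceil_root_gt0.
have g0y : (g0 <= y)%N.
  by rewrite -(leq_exp2r _ _ m0); apply: leq_trans g0k (ltnW (ltnW _)).
have nb : ~ bad_slabs v a0 a1 K y (S * L k) w by move=> h; apply: (nF k k1k); left.
have [q qP] : exists o : {ffun 'I_d -> 'I_(L k)},
    forall p, trap_set a0 (v k) p (w (@trap_bond d K.+1 (L k) (o, p)) : R).
  by apply: not_no_trap => h; apply: (nF k k1k); right.
have [tr clx] := trap_block (ltW (v0 k)) qP.
set x := trap_site _ _ in tr clx.
have xb : in_box 0 (\row_j (S * L k)%:Z) x.
  move=> j; rewrite !mxE; have := ltn_ord (q j).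
  move: (q j : nat) => u uL.
  have : (S * u.+1 <= S * L k)%N by rewrite leq_mul2l uL orbT.
  rewrite mulnS; move: (S * u)%N (S * L k)%N => Su SL; rewrite /S; lia.
exists x, (x - dirv a0), (x - dirv a0 - dirv a0); split => //.
have path : linked w (v y) ((l1dist 0%R x + 2) * (d * r)) 0 x.
  apply: (clean_path a01).
  - by move=> i; have := xb i; rewrite !mxE => /andP[].
  - move=> u ub; apply: (slabs_ok a01 nb) => i; have := ub i; have := xb i.
    by rewrite !mxE => /andP[_ xi] /andP[-> ui]; exact: le_trans xi.
  - by apply: clean_le cl0; exact: vmono.
  - by apply: clean_le clx; case/andP: (v01 y).
apply: linked_le path.
have lx : (l1dist 0%R x <= d * (S * L k))%N.
  apply: (@l1dist_box _ 0 (\row_j (S * L k)%:Z)) => // i.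
    by rewrite !mxE; lia.
  by rewrite !mxE subr0.
have L0 : (0 < L k)%N by rewrite expn_gt0 y0.
rewrite -/(L k) mulnAC leq_mul2r; apply/orP; right.
rewrite mulnDl -mulnA; apply: leq_add => //.
by rewrite leq_pmulr.
Qed.

(** * Lower bounds on return probabilities *)

(** C has to be measurable, so it is the infimum of the rescaled return probabilities. It is
    positive when they are eventually bounded below and the finitely many others are positive; the
    inequality itself then holds for every environment. *)
Lemma inf_random_variable (dT : measure_display) (T : measurableType dT)
    (R : realType) (P : probability T R) (f : nat -> T -> R) :
  (forall n, measurable_fun setT (f n)) -> (forall n w, 0 <= f n w) ->
  {ae P, forall w, (forall n, 0 < f n w) /\
    exists c n0, 0 < c /\ forall n, (n0 <= n)%N -> c <= f n w} ->
  exists C : {RV P >-> R}, {ae P, forall w, 0 < C w} /\ forall n w, C w <= f n w.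
Proof.
move=> mf f0 aef; pose C w := infs (f ^~ w) 0%N.
have lb w : has_lbound (range (f ^~ w)) by exists 0 => _ [n _ <-].
have mC : measurable_fun setT C by apply: measurable_fun_infs => // w _; exact: lb.
have Cle n w : C w <= f n w.
  by apply: ge_inf; [exists 0 => _ [l _ <-]|exists n].
pose CC : {mfun T >-> R} :=
  HB.pack C (isMeasurableFun.Build _ _ _ _ _ mC).
exists CC; split => //.
apply: filterS aef => w [fpos [c [n0 [c0 fc]]]].
have [c' c'0 c'f] : exists2 c', 0 < c' & forall n, (n < n0)%N -> c' <= f n w.
  elim: n0 {fc} => [|n0 [c' c'0 IH]]; first by exists 1.
  exists (Num.min c' (f n0 w)); first by rewrite lt_min c'0 fpos.
  move=> n; rewrite ltnS leq_eqVlt => /predU1P[->|/IH h]; first by rewrite ge_min lexx orbT.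
  by rewrite ge_min h.
apply: (@lt_le_trans _ _ (Num.min c c')); first by rewrite lt_min c0.
apply: lb_le_inf; first by exists (f 0%N w), 0%N.
move=> _ [n _ <-]; have [nn0|n0n] := ltnP n n0.
  by rewrite ge_min c'f ?orbT.
by rewrite ge_min fc.
Qed.

Lemma prob_gt0_gt_threshold (d : nat) (R : realType)
    (P : probability (environment d R) R) (Q : environment d R -> Prop) :
  (5 <= d)%N -> {ae P, forall w : environment d R, (forall b, 0 < (w b : R)) /\ Q w} ->
  forall b : bond d, ((percolation_threshold d R)%:E <
    P [set w : environment d R | (0 < (w b : R))%R])%E.
Proof.
move=> hd aew b; pose A := [set w : environment d R | (0 < (w b : R))%R].
have mA : measurable A.
  rewrite (_ : A = [set w : environment d R | `]0, +oo[%classic (w b : R)]).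
    by apply: measurable_bond; exact: measurable_itv.
  by apply/seteqP; split => w; rewrite /A /= in_itv/= andbT.
have PC : P (~` A) = 0%E.
  apply: measure_negligible; first exact: measurableC.
  by apply: negligibleS aew => w /= nA [h _]; apply: nA; exact: h.
have -> : P A = 1%E.
  by rewrite -[A]setCK probability_setC ?PC ?sube0//; exact: measurableC.
by rewrite lte_fin percolation_threshold_lt1.
Qed.

Lemma ceil_root_large m k y1 : (0 < m)%N -> (y1 ^ m <= k)%N -> (y1 <= ceil_root m k)%N.
Proof.
move=> m0 h; have [ky _] := ceil_rootP k m0.
by rewrite -(leq_exp2r _ _ m0); lia.
Qed.

(** Minimality gives (y - 1)^m <= k + 1 <= 2 (k - 1), and y <= 2 (y - 1). The form in k - 1 suits
    the bound 2^(k-1) < n. *)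
Lemma ceil_root_pow m k : (0 < m)%N -> (2 < k)%N ->
  (ceil_root m k ^ m <= 2 ^ m.+1 * k.-1)%N.
Proof.
move=> m0 k2; have [_] := ceil_rootP k m0; have := ceil_root_large m0 (k := k) (y1 := 1).
rewrite exp1n => /(_ (ltnW (ltnW k2))).
have [ky _] := ceil_rootP k m0; move: ky; set y := ceil_root m k => ky y1 yk.
have y2 : (1 < y)%N by case: y ky y1 {yk} => [|[|]] //; rewrite exp1n; lia.
apply: (@leq_trans ((2 * y.-1) ^ m)); first by rewrite leq_exp2r; lia.
rewrite expnMn expnS mulnAC mulnC leq_mul2r; apply/orP; right; lia.
Qed.

(** This m is the largest one for which a box of side y^s contains enough blocks; the last
    inequality is an equality at d = 5, s = 6. *)
Lemma trap_exponents (d s m : nat) : (5 <= d)%N -> (6 <= s)%N ->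
  m = (s * d - 4 * d - 2)%N ->
  [/\ (0 < m)%N, (m + 2 + 4 * d <= d * s)%N & (s + 2 <= m)%N].
Proof. by move=> hd hs ->; split; nia. Qed.

Lemma ln2_ge (R : realType) : 2^-1 <= ln (2 : R).
Proof.
rewrite -ler_expR lnK ?posrE// -[X in expR X]opprK expRN.
rewrite -[X in _ <= X]invrK lef_pV2 ?posrE ?expR_gt0 ?invr_gt0//.
by apply: le_trans (expR_ge1Dx _); lra.
Qed.

Lemma nstep_trapped (d : nat) (R : realType) (w : environment d R) (c N n : nat) k :
  (0 < d)%N -> trapped w (2^-1 ^+ c) (2^-1 ^+ k) N -> (N < n)%N -> (n <= 2 ^ k)%N ->
  ((2 * d * 2 ^ c) ^ (2 * N))%:R^-1 * (2^-1 ^+ k) ^+ 2 / (2 * d)%:R ^+ 2 *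
    expR (- (4 * d)%:R) <= nstep w (2 * n) (origin d) (origin d) :> R.
Proof.
move=> d0 [x [y [z [ox tr]]]] Nn nk.
have h0 : 0 <= 2^-1 :> R by lra.
have h1 : 2^-1 <= 1 :> R by lra.
have c01 : 0 <= (2^-1 ^+ c : R) <= 1 by rewrite exprn_ge0// exprn_ile1.
have nd : n%:R * 2^-1 ^+ k <= 1 :> R.
  by rewrite exprVn ler_pdivrMr ?exprn_gt0// mul1r -natrX ler_nat.
apply: le_trans (@nstep_trap d R w _ _ N n x y z (origin d) d0 c01 (exprn_ge0 _ h0) ox tr Nn nd).
rewrite le_eqVlt; apply/orP; left; apply/eqP; congr (_ * _).
rewrite [X in _ = _ * X]expr_div_n [RHS]mulrA; congr (_ * _ / _).
by rewrite natrX -exprVn natrM natrX invfM -exprVn mulrC.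
Qed.

Lemma ceil_root_le_pred m k : (1 < m)%N -> (3 < k)%N -> (ceil_root m k <= k.-1)%N.
Proof.
move=> m1 k3; have m0 : (0 < m)%N by exact: ltnW.
have [_] := ceil_rootP k m0; rewrite (leqNgt (ceil_root m k)); apply: contraL => h.
rewrite -leqNgt; apply: (@leq_trans (k.-1 ^ m)); last by rewrite leq_exp2r//; lia.
apply: (@leq_trans (k.-1 ^ 2)); last by rewrite leq_pexp2l//; lia.
nia.
Qed.

(** The journey at scale k + 1 has a cost and a length bounded in terms of k and [s k]; [s k.+1] is
    chosen afterwards, so large that lambda exceeds the cost and the time exceeds the length. *)
Lemma trap_scales_exist (R : realType) (lambda : nat -> R) (B E : nat -> nat -> nat) :
  lambda @ \oo --> +oo ->
  exists s : nat -> nat, [/\ s 0%N = 0%N, forall k, (s k < s k.+1)%N,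
    forall k, (E k (s k) < 2 ^ s k.+1)%N &
    forall k, (B k (s k))%:R <= lambda (2 * 2 ^ s k.+1)%N].
Proof.
move=> loo; have ex (p : nat * nat) : exists t, [/\ (p.2 < t)%N,
    (E p.1 p.2 < 2 ^ t)%N & (B p.1 p.2)%:R <= lambda (2 * 2 ^ t)%N].
  have /cvgryPge/(_ (B p.1 p.2)%:R)[M _ HM] := loo.
  pose t := (p.2.+1 + E p.1 p.2 + M)%N; exists t; split.
  - by rewrite /t; lia.
  - by apply: leq_ltn_trans (ltn_expl t _); rewrite /t//; lia.
  - apply: HM => /=; apply: (@leq_trans (2 ^ t)); last by rewrite leq_pmull.
    by apply: leq_trans (ltnW (ltn_expl t _)); rewrite /t//; lia.
have [g gP] := choice ex.
pose s := fix s k := if k is k'.+1 then g (k', s k') else 0%N.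
by exists s; split => // k; have [] := gP (k, s k).
Qed.

Lemma anomalous_subsequence (R : realType) (d : nat) (hd : (5 <= d)%N)
    (lambda : nat -> R) : lambda @ \oo --> +oo ->
  exists (P : probability (environment d R) R) (C : {RV P >-> R}) (nk : nat -> nat),
    [/\ iid_law P,
        forall b : bond d, ((percolation_threshold d R)%:E <
          P [set w : environment d R | (0 < (w b : R))%R])%E,
        {ae P, forall w, 0 < C w},
        (forall k : nat, (0 < nk k)%N) /\
          {homo nk : k l / (k < l)%N >-> (k < l)%N} &
        forall w k, C w / (lambda (nk k) * (nk k)%:R ^+ 2)
          <= nstep w (nk k) (origin d) (origin d)].
Proof.
(* Any admissible exponent would do here, as the sparse scales absorb the journey; 6 is the smallest
   that [trap_exponents] allows. *)
move=> loo; pose m := (6 * d - 4 * d - 2)%N.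
have [m0 em e2] := @trap_exponents d 6 m hd (leqnn _) erefl.
have [D HD] := trap_law_exists R hd m0 em.
have d0 : (0 < d)%N by exact: leq_trans hd.
pose N k := (D * ceil_root m k ^ 6)%N.
have [s [s0 sS sN sB]] := @trap_scales_exist R lambda
  (fun k t => (2 * d * 2 ^ t) ^ (2 * N k.+1))%N (fun k _ => N k.+1) loo.
have smono : {homo s : k l / (k < l)%N >-> (k < l)%N}.
  exact: homo_ltn ltn_trans sS.
pose v k : R := 2^-1 ^+ s k.
have h0 : 0 < 2^-1 :> R by lra.
have h1 : 2^-1 < 1 :> R by lra.
have v1 : v 0%N = 1 by rewrite /v s0 expr0.
have vdecr k : v k.+1 < v k by rewrite ltr_iXn2l.
have [P [Piid aeP]] := HD v v1 vdecr (fun k => exprn_gt0 _ h0).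
pose nk k := (2 * 2 ^ s k.+1)%N.
have nk0 k : (0 < nk k)%N by rewrite muln_gt0 expn_gt0.
have l1 k : 1 <= lambda (nk k).
  apply: le_trans (sB k); rewrite ler1n expn_gt0; apply/orP; left.
  by rewrite !muln_gt0 d0 expn_gt0.
pose f k w : R := nstep w (nk k) (origin d) (origin d) * (lambda (nk k) * (nk k)%:R ^+ 2).
have w0 k : 0 < lambda (nk k) * (nk k)%:R ^+ 2.
  by rewrite mulr_gt0 ?exprn_gt0 ?ltr0n// (lt_le_trans ltr01).
have mf k : measurable_fun setT (f k).
  by apply: measurable_funM => //; exact: measurable_nstep.
have f0 k w : 0 <= f k w by rewrite mulr_ge0 ?nstep_ge0// ltW.
have [|C [Cpos Cle]] := inf_random_variable mf f0 (P := P); last first.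
  exists P, C, nk; split => //.
  - exact: prob_gt0_gt_threshold hd aeP.
  - by split => // k l kl; rewrite ltn_pmul2l// ltn_exp2l//; apply: smono.
  - by move=> w k; rewrite ler_pdivrMr//; exact: Cle.
apply: filterS aeP => w [wpos [k0 trapk]]; split.
  by move=> k; rewrite mulr_gt0// (nstep_even_gt0 (Ordinal d0)).
exists ((d%:R ^+ 2)^-1 * expR (- (4 * d)%:R)), (maxn k0 4).
split; first by rewrite mulr_gt0 ?expR_gt0// invr_gt0 exprn_gt0// ltr0n.
move=> k; rewrite geq_max => /andP[k0k k4].
have tr := trapk k.+1 (leqW k0k); rewrite -/(N k.+1) in tr.
(* The journey to the trap of scale k + 1 only uses conductances at least [v k], fixed before
   [s k.+1]. *)
have yk : (ceil_root m k.+1 <= k)%N by apply: ceil_root_le_pred => //; lia.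
have {}tr : trapped w (2^-1 ^+ s k) (2^-1 ^+ s k.+1) (N k.+1).
  move: tr => [x [y [z [[l lN ox] tr]]]]; exists x, y, z; split => //.
  exists l => //; apply: reach_le ox; rewrite /v ler_iXn2l//.
  by move: yk; rewrite leq_eqVlt => /predU1P[->//|/smono/ltnW].
have := nstep_trapped d0 tr (sN k) (leqnn _); rewrite -/(nk k).
set X := ((2 * d * 2 ^ s k) ^ (2 * N k.+1))%N.
move: (expR _) (expR_ge0 (- (4 * d)%:R : R)) => E E0 low.
rewrite /f; apply: le_trans (ler_wpM2r (ltW (w0 k)) low).
have X0 : 0 < X%:R :> R by rewrite ltr0n expn_gt0 !muln_gt0 d0 expn_gt0.
have dR : 0 < d%:R :> R by rewrite ltr0n.
have t0 : 0 < 2 ^+ s k.+1 :> R by rewrite exprn_gt0.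
have Xlam : X%:R <= lambda (nk k) := sB k.
rewrite (_ : (nk k)%:R = 2 * 2 ^+ s k.+1); last by rewrite natrM natrX.
rewrite exprVn natrM; move: X%:R (lambda (nk k)) (2 ^+ s k.+1) d%:R X0 Xlam t0 dR.
move=> A lam B D' A0 Alam B0 D0.
rewrite [leRHS](_ : _ = (lam / A) * ((D' ^+ 2)^-1 * E)).
  rewrite -[leLHS]mul1r ler_wpM2r//.
    by rewrite mulr_ge0// invr_ge0 exprn_ge0// ltW.
  by rewrite ler_pdivlMr// mul1r.
by field; rewrite !gt_eqF.
Qed.

(** ln n >= (k - 1) ln 2 is at least y^m / 2^(m+2), so its power kappa is at least q y^(kappa m).
    The surplus [eta] of kappa m over e + 1 beats B / q as soon as y >= (B / q)^(1 / eta). *)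
Lemma ceil_root_pow_le_ln_powR (R : realType) (m e B : nat) (kappa : R) :
  (0 < m)%N -> 0 < kappa -> e.+1%:R < kappa * m%:R ->
  exists k1, forall k n, (k1 <= k)%N -> (2 ^ k.-1 < n)%N ->
    B%:R * (ceil_root m k)%:R ^+ e.+1 <= ln (n%:R : R) `^ kappa.
Proof.
move=> m0 kappa0 em; pose eta := kappa * m%:R - e.+1%:R.
have eta0 : 0 < eta by rewrite subr_gt0.
pose q : R := ((2 ^+ m.+2)^-1) `^ kappa.
have q0 : 0 < q by rewrite powR_gt0// invr_gt0 exprn_gt0.
pose y1 := (Num.trunc ((B%:R / q) `^ eta^-1)).+1.
exists (maxn 3 (y1 ^ m)) => k n; rewrite geq_max => /andP[k3 ky1] kn.
have yk := ceil_root_large m0 ky1; have := ceil_root_pow m0 k3.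
move: (ceil_root m k) yk => y y1y ym.
have y0 : 0 < y%:R :> R by rewrite ltr0n; exact: leq_trans y1y.
have n0 : (0 < n)%N by exact: leq_ltn_trans kn.
have lnn : y%:R ^+ m / 2 ^+ m.+2 <= ln (n%:R : R).
  apply: (@le_trans _ _ (k.-1%:R * ln 2)).
    rewrite ler_pdivrMr ?exprn_gt0//.
    have h : y%:R ^+ m <= 2 ^+ m.+1 * k.-1%:R :> R by rewrite -natrX -natrX -natrM ler_nat.
    apply: le_trans h _; have -> : k.-1%:R * ln 2 * 2 ^+ m.+2 =
      2 ^+ m.+1 * k.-1%:R * (2 * ln 2) :> R by rewrite [2 ^+ m.+2]exprS; ring.
    by rewrite ler_peMr ?mulr_ge0 ?exprn_ge0//; have := ln2_ge R; lra.
  rewrite mulr_natl -lnXn// ler_ln ?posrE ?exprn_gt0 ?ltr0n//.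
  by rewrite -natrX ler_nat ltnW.
apply: (@le_trans _ _ ((y%:R ^+ m / 2 ^+ m.+2) `^ kappa)); last first.
  have a0 : 0 <= y%:R ^+ m / 2 ^+ m.+2 :> R by rewrite divr_ge0 ?exprn_ge0.
  by apply: ge0_ler_powR; rewrite ?nnegrE ?(ltW kappa0) ?(le_trans a0).
rewrite powRM ?exprn_ge0 ?invr_ge0 ?exprn_ge0// -/q.
rewrite -(powR_mulrn m (ltW y0)) -powRrM.
have -> : m%:R * kappa = e.+1%:R + eta by rewrite /eta addrC subrK mulrC.
rewrite powRD ?(gt_eqF y0) ?implybT// powR_mulrn ?(ltW y0)//.
rewrite mulrC -mulrA ler_wpM2l ?exprn_ge0 ?(ltW y0)//.
rewrite -ler_pdivrMr//.
have Bq : 0 <= B%:R / q by rewrite divr_ge0// ltW.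
have -> : B%:R / q = ((B%:R / q) `^ eta^-1) `^ eta.
  by rewrite -powRrM mulVf ?gt_eqF// powRr1.
apply: ge0_ler_powR; rewrite ?nnegrE ?powR_ge0 ?(ltW eta0) ?(ltW y0)//.
apply: le_trans (_ : y1%:R <= _); last by rewrite ler_nat.
by rewrite ltW// truncnS_gt.
Qed.

(** The inequality is linear in s with slope kappa d - 1 > 0, and [t] is the point where it becomes
    an equality. *)
Lemma trap_exponent_exists (R : realType) (d : nat) (kappa : R) :
  (5 <= d)%N -> 1 / d%:R < kappa ->
  exists2 s, (6 <= s)%N & s.+1%:R < kappa * (s * d - 4 * d - 2)%N%:R.
Proof.
move=> hd kd; have dR : 0 < d%:R :> R by rewrite ltr0n; exact: leq_trans hd.
have kd1 : 0 < kappa * d%:R - 1 by rewrite subr_gt0 -ltr_pdivrMr.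
pose t := (1 + kappa * (4 * d + 2)%:R) / (kappa * d%:R - 1).
exists (6 + (Num.trunc t).+1)%N; first by rewrite leq_addr.
have := truncnS_gt t; set T := (Num.trunc t).+1 => tT.
have sT : T%:R <= (6 + T)%:R :> R by rewrite ler_nat leq_addl.
have le : (4 * d + 2 <= (6 + T) * d)%N by nia.
rewrite -subnDA natrB// natrM -natr1; move: (lt_le_trans tT sT).
by rewrite /t ltr_pdivrMr//; move: ((6 + T)%:R) ((4 * d + 2)%:R) => A B; nra.
Qed.

Lemma anomalous_decay (R : realType) (d : nat) (hd : (5 <= d)%N) (kappa : R) :
  1 / d%:R < kappa ->
  exists (P : probability (environment d R) R) (C : {RV P >-> R}),
    [/\ iid_law P,
        forall b : bond d, ((percolation_threshold d R)%:E <
          P [set w : environment d R | (0 < (w b : R))%R])%E,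
        {ae P, forall w, 0 < C w} &
        forall w n, (1 <= n)%N ->
          C w * (expR (- (ln n%:R `^ kappa)) / n%:R ^+ 2)
            <= nstep w (2 * n) (origin d) (origin d)].
Proof.
move=> kd; have [e e6 ekm] := trap_exponent_exists hd kd.
set m := (e * d - 4 * d - 2)%N in ekm.
have [m0 em e2] := trap_exponents hd e6 (erefl m).
have em1 : (e.+1 <= m)%N by apply: leq_trans e2; rewrite addn2.
have d0 : (0 < d)%N by exact: leq_trans hd.
have dR : 0 < d%:R :> R by rewrite ltr0n.
have kappa0 : 0 < kappa by apply: lt_trans kd; rewrite divr_gt0.
have [D HD] := trap_law_exists R hd m0 em.
have h0 : 0 < 2^-1 :> R by lra.
have h1 : 2^-1 < 1 :> R by lra.
pose v k : R := 2^-1 ^+ k.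
have vdecr k : v k.+1 < v k by rewrite ltr_iXn2l.
have [P [Piid aeP]] := HD v (expr0 _) vdecr (fun k => exprn_gt0 _ h0).
pose g n : R := n.+1%:R ^+ 2 * expR (ln n.+1%:R `^ kappa).
have g0 n : 0 < g n by rewrite mulr_gt0 ?expR_gt0// exprn_gt0// ltr0n.
pose f n w : R := nstep w (2 * n.+1) (origin d) (origin d) * g n.
have mf n : measurable_fun setT (f n).
  by apply: measurable_funM => //; exact: measurable_nstep.
have f0 n w : 0 <= f n w by rewrite mulr_ge0 ?nstep_ge0// ltW.
have [|C [Cpos Cle]] := inf_random_variable mf f0 (P := P); last first.
  exists P, C; split => //; first exact: prob_gt0_gt_threshold hd aeP.
  move=> w [//|n] _; rewrite expRN -invfM mulrC [expR _ * _]mulrC -/(g n).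
  by rewrite mulrC ler_pdivrMr//; exact: Cle.
apply: filterS aeP => w [wpos [k0 trapk]]; split.
  by move=> n; rewrite mulr_gt0// (nstep_even_gt0 (Ordinal d0)).
(* The journey costs (2 d 2^y)^(2 D y^e), and 2 d 2^y <= 2^(2 d + y) <= 2^((2 d + 1) y), so it is at
   most 2^(B y^(e+1)). *)
pose B := ((2 * d + 1) * (2 * D))%N.
have [k1 Hk1] := ceil_root_pow_le_ln_powR B m0 kappa0 ekm.
pose k2 := maxn (maxn k0 k1) (maxn 3 ((D * 2 ^ m.+1).+1 ^ m)).
exists (4^-1 / (2 * d)%:R ^+ 2 * expR (- (4 * d)%:R)), (2 ^ k2)%N.
split; first by rewrite mulr_gt0 ?expR_gt0// divr_gt0// exprn_gt0// ltr0n muln_gt0.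
(* The scale with 2^(k-1) < n <= 2^k: the trap holds for time n, and replacing 2^k by n loses at
   most the factor 4. *)
move=> n' n'k2; pose n := n'.+1; pose k := up_log 2 n.
have nk : (n <= 2 ^ k)%N by exact: up_logP.
have kk2 : (k2 <= k)%N.
  by rewrite -(@leq_exp2l 2)//; apply: leq_trans nk; exact: leqW.
have : (k2 <= k)%N by []; rewrite {1}/k2 !geq_max => /andP[/andP[k0k k1k] /andP[k3 ky]].
have n1 : (1 < n)%N.
  rewrite /n ltnS; apply: leq_trans n'k2; by rewrite expn_gt0.
have kn : (2 ^ k.-1 < n)%N by have /andP[] := up_log_bounds (isT : 1 < 2)%N n1.
have := trapk k k0k; have := Hk1 k n k1k kn.
have := ceil_root_large m0 ky; have := ceil_root_pow m0 k3.
set y := ceil_root m k => ym yD lnn tr.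
have y0 : (0 < y)%N by exact: leq_trans yD.
set N := (D * y ^ e)%N in tr.
(* As y exceeds D 2^(m+1), the length satisfies 2^(m+1) D y^e <= y^(e+1) <= y^m <= 2^(m+1) (k - 1),
   and k - 1 < 2^(k-1) < n. *)
have Nn : (N < n)%N.
  apply: leq_ltn_trans kn; apply: (@leq_trans k.-1); last exact/ltnW/ltn_expl.
  rewrite -(@leq_pmul2l (2 ^ m.+1)) ?expn_gt0//; apply: leq_trans ym.
  apply: (@leq_trans (y ^ e.+1)); last by rewrite leq_pexp2l.
  rewrite /N mulnA (expnS y) leq_mul2r; apply/orP; right.
  by rewrite mulnC; exact: ltnW.
have := nstep_trapped d0 tr Nn nk.
set X := ((2 * d * 2 ^ y) ^ (2 * N))%N => low.
have X0 : 0 < X%:R :> R by rewrite ltr0n expn_gt0 !muln_gt0 d0 expn_gt0.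
have XE : X%:R <= expR (ln n%:R `^ kappa) :> R.
  apply: le_trans (_ : expR (B%:R * y%:R ^+ e.+1) <= _); last by rewrite ler_expR.
  have -> : B%:R * y%:R ^+ e.+1 = (B * y ^ e.+1)%:R * 1 :> R.
    by rewrite mulr1 natrM natrX.
  rewrite expRM_natl.
  apply: (@le_trans _ _ (2 ^+ (B * y ^ e.+1))); last first.
    by rewrite lerXn2r ?nnegrE ?expR_ge0//; apply: le_trans (expR_ge1Dx _); lra.
  rewrite -natrX ler_nat; apply: (@leq_trans ((2 ^ (2 * d + y)) ^ (2 * N))).
    rewrite /X; case: (2 * N)%N => [|j]; first by rewrite !expn0.
    by rewrite leq_exp2r// expnD leq_mul2r (ltnW (ltn_expl _ _)) ?orbT.
  rewrite -expnM leq_pexp2l// /B /N (expnS y); move: (y ^ e)%N => Z.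
  have h : (2 * d + y <= (2 * d + 1) * y)%N.
    by rewrite mulnDl mul1n leq_add2r leq_pmulr.
  apply: leq_trans (leq_mul h (leqnn _)) _.
  by clear; lia.
have n2 : 4^-1 <= (2^-1 ^+ k) ^+ 2 * n%:R ^+ 2 :> R.
  rewrite -exprMn (_ : 4^-1 = 2^-1 ^+ 2 :> R); last by field.
  rewrite lerXn2r ?nnegrE ?mulr_ge0 ?exprn_ge0 ?(ltW h0)//.
  have kE : k = k.-1.+1 by rewrite prednK// (leq_trans _ k3).
  rewrite exprVn ler_pdivlMl ?exprn_gt0// kE exprS mulrAC divff// mul1r.
  by rewrite -natrX ler_nat ltnW.
move: (expR (- _)) (expR_ge0 (- (4 * d)%:R : R)) low => E E0 low.
rewrite /f; apply: le_trans (ler_wpM2r (ltW (g0 _)) low).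
rewrite -[g n']/(n%:R ^+ 2 * expR (ln n%:R `^ kappa)).
move: (expR (ln n%:R `^ kappa)) XE => F.
move: X%:R (2^-1 ^+ k) (n%:R : R) X0 n2 => A t u A0 tu AF.
have dd0 : (2 * d)%:R != 0 :> R by rewrite pnatr_eq0 muln_eq0 -lt0n d0.
rewrite [leRHS](_ : _ = (F / A) * (t ^+ 2 * u ^+ 2) * (((2 * d)%:R ^+ 2)^-1 * E)).
  rewrite -[leLHS]mulrA; apply: ler_wpM2r; first by rewrite mulr_ge0// invr_ge0 exprn_ge0.
  have tu0 : 0 <= t ^+ 2 * u ^+ 2 by apply: le_trans tu; rewrite invr_ge0.
  apply: le_trans tu _; rewrite ler_peMl//.
  by rewrite ler_pdivlMr// mul1r.
move: (2 * d)%:R dd0 => D' D'0; field.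
by rewrite D'0 gt_eqF.
Qed.

Theorem theorem2p2 (R : realType) (d : nat) (hd : (5 <= d)%N) :
  (forall kappa : R, 1 / d%:R < kappa ->
    exists (P : probability (environment d R) R) (C : {RV P >-> R}),
      [/\ iid_law P,
          forall b : bond d,
            ((percolation_threshold d R)%:E <
               P [set w : environment d R | (0 < (w b : R))%R])%E,
          {ae P, forall w, 0 < C w} &
          {ae P, forall w, infinite_cluster w (origin d) ->
            forall n : nat, (1 <= n)%N ->
              C w * (expR (- (ln n%:R `^ kappa)) / n%:R ^+ 2)
                <= nstep w (2 * n) (origin d) (origin d)}]) /\
  (forall lambda : nat -> R,
    (forall m n : nat, (1 <= m)%N -> (m <= n)%N -> lambda m <= lambda n) ->
    lambda @ \oo --> +oo ->
    exists (P : probability (environment d R) R) (C : {RV P >-> R})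
           (nk : nat -> nat),
      [/\ iid_law P,
          forall b : bond d,
            ((percolation_threshold d R)%:E <
               P [set w : environment d R | (0 < (w b : R))%R])%E,
          {ae P, forall w, 0 < C w},
          (forall k : nat, (0 < nk k)%N) /\
            {homo nk : k l / (k < l)%N >-> (k < l)%N} &
          {ae P, forall w, infinite_cluster w (origin d) ->
            forall n : nat, range nk n ->
              C w / (lambda n * n%:R ^+ 2)
                <= nstep w n (origin d) (origin d)}]).
Proof.
split=> [kappa kd|lambda _ loo].
  have [P [C [Piid Pth Cpos Cle]]] := anomalous_decay hd kd.
  by exists P, C; split => //; apply: aeW => w _ n; exact: Cle.
have [P [C [nk [Piid Pth Cpos nkP Cle]]]] := anomalous_subsequence hd loo.
by exists P, C, nk; split => //; apply: aeW => w _ _ [k _ <-]; exact: Cle.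
Qed.
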